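(* Let $\phi=\frac{1+\sqrt5}{2}$ be the golden ratio and assume $\phi+1<\tau<3$ and $\alpha>\frac{\tau-1}{\tau-2}$. Let $\mathcal{G}=(\mathcal{V},\mathcal{E})$ be a (Euclidean) GIRG with parameters $\tau,\alpha,\theta_1,\theta_2,d,n$, and let the vertex where the rumour starts be arbitrary. There exist $\rho_1,\rho_2>0$ such that with high probability at most $O(n^{1-\rho_1})$ vertices are informed of the rumour after $n^{\rho_2}$ rounds of the push-pull protocol.
   Context: All asymptotics are for $n\to\infty$ with the other parameters constant; ''with high probability'' (whp) means with probability $1-o(1)$. GIRG. Let $\tau>2$, $\alpha>1$, $0<\theta_1\le\theta_2\le 1$, $d,n\in\mathbb{N}$, and let $\mathcal{D}$ be a power-law distribution on $[1,\infty)$ with exponent $\tau$ (it has a density $f$ with $f(x)=\Theta(x^{-\tau})$, or, in the discrete case, point probabilities $\Theta(x^{-\tau})$). Let $\mathbb{T}^d=\mathbb{R}^d/\mathbb{Z}^d$ be the $d$-dimensional torus; for $a,b\in[0,1]$ let $|a-b|_T=\min\{|a-b|,1-|a-b|\}$, and for $x,y\in\mathbb{T}^d$ let $|x-y|_\infty=\max_{1\le i\le d}|x_i-y_i|_T$. Let $V_\infty(r)=\mathrm{Vol}(\{x\in\mathbb{T}^d: |x|_\infty\le r\})$. A (Euclidean) Geometric Inhomogeneous Random Graph (GIRG) is the random graph obtained as follows: (1) the vertex set $\mathcal{V}$ is a Poisson point process of intensity $n$ on $\mathbb{T}^d$; $x_v$ denotes the position of vertex $v$; (2) every vertex $v$ independently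 draws a weight $W_v\sim\mathcal{D}$; (3) every two distinct vertices $u,v$ are joined by an edge independently with probability $p_{uv}$ satisfying $\theta_1 m\le p_{uv}\le\theta_2 m$, where $m=\min\left\{\left(\frac{W_uW_v}{nV_\infty(|x_u-x_v|_\infty)}\right)^{\alpha},1\right\}$. (Synchronous) push-pull protocol. Initially only the start vertex knows the rumour. In each round, every (non-isolated) vertex independently chooses a uniformly random neighbour, and the two vertices share the rumour: if one of them knew it before this round, then both know it after this round. *)

(* Defs.v *)
From HB Require Import structures.
From mathcomp Require Import all_boot all_order all_algebra.
From mathcomp Require Import all_classical all_reals all_analysis.
Set Implicit Arguments.
Unset Strict Implicit.
Unset Printing Implicit Defensive.
Import Order.TTheory GRing.Theory Num.Theory.
Import numFieldNormedType.Exports.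
Local Open Scope classical_set_scope.
Local Open Scope ring_scope.

Section torus.
Variable R : realType.

(* A point of T^d = R^d / Z^d is given by its representative in [0, 1[^d. *)
Definition torus d : set (d.-tuple R) :=
  [set x | forall i, 0 <= tnth x i < 1].

Definition tuple_cons d (z : measurableTypeR R * d.-tuple R) : d.+1.-tuple R :=
  [tuple of z.1 :: z.2].

Lemma measurable_tuple_cons d :
  measurable_fun [set: measurableTypeR R * d.-tuple R] (@tuple_cons d).
Proof.
apply: (@measurable_cons _ _ _ R (fst : measurableTypeR R * d.-tuple R -> R)).
  exact: measurable_fst.
exact: measurable_snd.
Qed.

HB.instance Definition _ d :=
  isMeasurableFun.Build _ _ _ _ (@tuple_cons d) (@measurable_tuple_cons d).

(* Lebesgue measure on the torus: the d-fold product of the uniform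
   probability measure on [0, 1]. *)
Fixpoint torus_volume d : probability (d.-tuple R) R :=
  match d with
  | 0 => \d_[tuple]
  | d'.+1 =>
      distribution (uniform_prob (@ltr01 R) \x torus_volume d')%E (@tuple_cons d')
  end.

Definition circle_dist (a b : R) : R := Num.min `|a - b| (1 - `|a - b|).

Definition torus_dist d (x y : d.-tuple R) : R :=
  \big[Num.max/0]_(i < d) circle_dist (tnth x i) (tnth y i).

Definition ball_volume d (r : R) : R :=
  fine (torus_volume d [set x | torus_dist x [tuple 0 | _ < d] <= r]).

(* The quotient is +oo when the ball has volume 0 (coinciding vertices). *)
Definition edge_weight d (n : nat) (alpha : R) (u v : d.-tuple R * R) : R :=
  let V := ball_volume d (torus_dist u.1 v.1) in
  if V == 0 then 1 else Num.min ((u.2 * v.2 / (n%:R * V)) `^ alpha) 1.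

(* Unlike [poisson_pmf], this is the Dirac mass at 0 when [lambda = 0]. *)
Definition poisson_mass (lambda : R) (m : nat) : R :=
  expR (- lambda) * lambda ^+ m / m`!%:R.

End torus.

Section power_law.
Variable R : realType.

Definition density_power_law (tau : R) (D : probability R R) :=
  exists f : R -> R, [/\ measurable_fun setT f,
    forall x, 0 <= f x,
    forall x, x < 1 -> f x = 0,
    forall A, measurable A -> D A = (\int[lebesgue_measure]_(x in A) (f x)%:E)%E &
    exists c1 c2 : R, [/\ 0 < c1, 0 < c2 &
      \forall x \near +oo, c1 * x `^ (- tau) <= f x <= c2 * x `^ (- tau)]].

(* The discrete case: the support lies in the positive integers. *)
Definition discrete_power_law (tau : R) (D : probability R R) :=
  D [set k.+1%:R | k in [set: nat]] = 1%E /\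
  exists c1 c2 : R, [/\ 0 < c1, 0 < c2 &
    \forall k \near \oo, c1 * k%:R `^ (- tau) <= fine (D [set k%:R])
                         <= c2 * k%:R `^ (- tau)].

Definition power_law (tau : R) (D : probability R R) :=
  density_power_law tau D \/ discrete_power_law tau D.

End power_law.

(* The vertices are labelled 0, ..., N - 1; the variables carrying a label
   >= N are irrelevant. *)
Record girg (R : realType) (d n : nat) (alpha theta1 theta2 : R)
    (D : probability R R) (disp : measure_display) (Omega : measurableType disp)
    (P : probability Omega R) := Girg {
  num_vertices : {RV P >-> nat};
  position : nat -> {RV P >-> (d.-tuple R)};
  weight : nat -> {RV P >-> R};
  edge : nat -> nat -> {RV P >-> bool};
  edge_prob : forall k, k.-tuple (d.-tuple R * R) -> 'I_k -> 'I_k -> R;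

  positions k (w : Omega) : k.-tuple (d.-tuple R) :=
    [tuple position i w | i < k];
  marks k (w : Omega) : k.-tuple (d.-tuple R * R) :=
    [tuple (position i w, weight i w) | i < k];

  position_torus : forall w i, (i < num_vertices w)%N -> @torus R d (position i w);
  (* Poisson point process of intensity n: the numbers of points in disjoint
     measurable sets are independent Poisson variables. *)
  poisson_process : forall k (A : 'I_k -> set (d.-tuple R)) (m : 'I_k -> nat),
    (forall i, measurable (A i)) -> trivIset setT A ->
    P [set w | forall i,
         (\sum_(v < num_vertices w) (position v w \in A i) = m i)%N] =
    (\prod_(i < k)
        poisson_mass (n%:R * fine (torus_volume R d (A i))) (m i))%:E;
  (* Given the positions, the weights are independent with law D. *)
  weight_law : forall k (A : set (k.-tuple (d.-tuple R))) (B : 'I_k -> set R),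
    measurable A -> (forall i, measurable (B i)) ->
    P [set w | [/\ num_vertices w = k, A (positions k w) &
                   forall i : 'I_k, B i (weight i w)]] =
    (P [set w | num_vertices w = k /\ A (positions k w)] *
       \prod_(i < k) D (B i))%E;
  edge_sym : forall w u v, edge u v w = edge v u w;
  edge_irr : forall w v, edge v v w = false;
  edge_prob_measurable : forall k (i j : 'I_k),
    measurable_fun setT (fun z => @edge_prob k z i j);
  edge_prob_bounds : forall k (z : k.-tuple (d.-tuple R * R)) (i j : 'I_k),
    (forall l, @torus R d (tnth z l).1 /\ 1 <= (tnth z l).2) -> (i < j)%N ->
    theta1 * edge_weight n alpha (tnth z i) (tnth z j) <= edge_prob z i j
      <= theta2 * edge_weight n alpha (tnth z i) (tnth z j);
  (* Given the positions and weights, the edges are independent, with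
     probabilities [edge_prob]. *)
  edge_law : forall k (A : set (k.-tuple (d.-tuple R * R))) (e : rel 'I_k),
    measurable A ->
    P [set w | [/\ num_vertices w = k, A (marks k w) &
                   forall i j : 'I_k, (i < j)%N -> edge i j w = e i j]] =
    (\int[P]_(w in [set w | num_vertices w = k /\ A (marks k w)])
       (\prod_(i < k) \prod_(j < k | (i < j)%N)
          let p := edge_prob (marks k w) i j in
          if e i j then p else 1 - p)%:E)%E
}.

(* The informed vertices after [t] rounds of the synchronous protocol on the
   graph [e], where [call r v] is the vertex chosen by [v] in round [r]. *)
Fixpoint informed k (e : rel 'I_k) (s : nat) (call : nat -> nat -> nat)
    (t : nat) : {set 'I_k} :=
  match t with
  | 0 => [set v : 'I_k | val v == s]
  | r.+1 =>
      let I := informed e s call r in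
      I :|: [set v | [exists u in I,
        e u v && ((call r u == v) || (call r v == u))]]
  end%SET.

Definition degree k (e : rel 'I_k) (v : 'I_k) : nat := #|[set u | e v u]|%SET.

(* The start vertex may depend on the positions, the weights and the graph
   (and on further randomness); given all of these, the calls of the
   non-isolated vertices are independent and uniform among the neighbours. *)
Record push_pull (R : realType) (d n : nat) (alpha theta1 theta2 : R)
    (D : probability R R) (disp : measure_display) (Omega : measurableType disp)
    (P : probability Omega R) (G : girg d n alpha theta1 theta2 D P) := PushPull {
  start : {RV P >-> nat};
  call : nat -> nat -> {RV P >-> nat};

  start_vertex : forall w, (0 < num_vertices G w)%N -> (start w < num_vertices G w)%N;
  call_law : forall k (A : set (k.-tuple (d.-tuple R * R))) (e : rel 'I_k)
      (s T : nat) (h : nat -> 'I_k -> 'I_k),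
    measurable A ->
    let E := [set w | [/\ num_vertices G w = k, A (marks G k w),
                forall i j : 'I_k, edge G i j w = e i j & start w = s]] in
    P (E `&` [set w | forall (r : nat) (v : 'I_k), (r < T)%N ->
                (0 < degree e v)%N -> call r v w = h r v]) =
    (P E * (\prod_(r < T) \prod_(v < k | (0 < degree e v)%N)
       if e v (h r v) then (degree e v)%:R^-1 else 0)%:E)%E
}.

Definition num_informed (R : realType) (d n : nat) (alpha theta1 theta2 : R)
    (D : probability R R) (disp : measure_display) (Omega : measurableType disp)
    (P : probability Omega R) (G : girg d n alpha theta1 theta2 D P)
    (Q : push_pull G) (t : nat) (w : Omega) : nat :=
  #|@informed (num_vertices G w) (fun u v => edge G u v w) (start Q w)
      (fun r v => call Q r v w) t|.

Definition golden_ratio (R : realType) : R := (1 + Num.sqrt 5) / 2.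

(* Main.v *)
(** A call between u and v has probability about p_uv / min(W_u, W_v) in each round,
    since the degree of u is of order W_u. As min(y^alpha, 1) <= y^beta for every
    beta <= alpha, the expected number of calls per round along edges of length
    n^(-o(1)) is at most about
    n^(2 - beta) E[W^(beta - 1)] E[W^beta; W <= n^(1 / (tau - 1))],
    which is n^(1 + beta / (tau - 1) - beta) for tau - 1 < beta < tau. Some
    beta <= alpha makes this exponent negative because tau > phi + 1 and
    alpha > (tau - 1) / (tau - 2). Hence, with high probability, no edge of length
    r0 = n^(-o(1)) is used during the first T = n^u rounds, every informed vertex lies
    within T r0 of the start vertex, and each ball of that radius contains only
    n^(1 - rho) vertices.

    The degree of u enters only through E[1_uv / deg u], which is bounded by
    p_uv / (theta1 m) where m is the number of vertices in the cell of u in a grid so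
    fine that vertices of one cell are joined to u with probability at least theta1.
    Summed over u, the terms 1 / m count the occupied cells. *)

Require Import Defs.
From mathcomp Require Import all_boot all_order all_algebra.
From mathcomp Require Import all_classical all_reals all_analysis.
From mathcomp Require Import measurable_realfun lra ring zify.
Set Implicit Arguments.
Unset Strict Implicit.
Unset Printing Implicit Defensive.
Import Order.TTheory GRing.Theory Num.Theory.
Import numFieldNormedType.Exports.
Local Open Scope classical_set_scope.
Local Open Scope ring_scope.

(** * Independent Bernoulli edges *)

(** The start vertex may depend on the marks and on the graph, so the rumour cannot be followed from
    it with fresh randomness. Every estimate is a union bound instead: over all pairs, rounds and
    weight classes for the far calls, and over balls around the points of a fixed grid for the final
    count. Positions are not averaged in a far call; only the lower bound r0 on the distance enters,
    where r0 is of order n^(-2u) for a small constant u. The expectations over weights become finite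
    sums: weights are sorted into classes [b^i, b^(i+1)) with b = n^eps and i < L, and since L does
    not depend on n, it is enough to compare the exponents of L^2 summands. All losses (r0, the
    width of the classes, the number of rounds, the cutoff n^(1+u) for the Poisson number of
    vertices) are of the form n^(O(u)) and are paid from the single gap beta - 1 - beta / (tau -
    1). *)

Section bernoulli.
Variables (R : realFieldType) (I : finType) (p : I -> R).

Definition bernoulli_weight (f : {ffun I -> bool}) : R :=
  \prod_i (if f i then p i else 1 - p i).

Definition flip_at (j : I) (f : {ffun I -> bool}) : {ffun I -> bool} :=
  [ffun i => (i == j) (+) f i].

Lemma flip_atK j : involutive (flip_at j).
Proof. by move=> f; apply/ffunP => i; rewrite !ffunE addbA addbb. Qed.

(** Flipping coordinate [j] pairs the terms of the difference of the two sides. With Z the product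
    of the other factors, a pair contributes (1 - p_j) p_j Z G and - p_j (1 - p_j) Z G, which
    cancel. *)
Lemma bernoulli_indep j (G : {ffun I -> bool} -> R) :
  (forall f, G (flip_at j f) = G f) ->
  \sum_f bernoulli_weight f * ((f j)%:R * G f) =
  p j * \sum_f bernoulli_weight f * G f.
Proof.
move=> GE; rewrite mulr_sumr; apply/eqP; rewrite -subr_eq0 -sumrB.
set S := \sum_f _; suff : S + S = 0 by move=> SS; apply/eqP; lra.
rewrite {1}/S (reindex_inj (inv_inj (@flip_atK j)))/= /S -big_split/= big1//.
move=> f _; rewrite GE /bernoulli_weight [flip_at j f j]ffunE eqxx.
rewrite (bigD1 j)//= [X in _ + X](_ : _ = (if f j then p j else 1 - p j) *
    \prod_(i | i != j) (if f i then p i else 1 - p i) * ((f j)%:R * G f) -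
    p j * ((if f j then p j else 1 - p j) *
    \prod_(i | i != j) (if f i then p i else 1 - p i) * G f)); last first.
  by rewrite [in LHS](bigD1 j)//=.
have -> : \prod_(i | i != j) (if flip_at j f i then p i else 1 - p i) =
          \prod_(i | i != j) (if f i then p i else 1 - p i).
  by apply: eq_bigr => i ij; rewrite ffunE (negbTE ij).
rewrite ffunE eqxx; set Z := \prod_(i | _) _; case: (f j) => /=; ring.
Qed.

Lemma bernoulli_weight_sum : \sum_f bernoulli_weight f = 1.
Proof.
rewrite /bernoulli_weight -(bigA_distr_bigA (fun i (b : bool) =>
  if b then p i else 1 - p i)) /= big1// => i _.
by rewrite big_bool/= addrC subrK.
Qed.

Hypothesis p01 : forall i, 0 <= p i <= 1.

Lemma bernoulli_weight_ge0 f : 0 <= bernoulli_weight f.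
Proof.
by apply: prodr_ge0 => i _; have /andP[? ?] := p01 i; case: ifP; rewrite ?subr_ge0.
Qed.

(* Writing S for the number of successes in J and S_j for S without j, the
   variable f_j / S equals f_j / (1 + S_j), f_j is independent of S_j, and the
   sum over j of f_j / S is at most 1. *)
Lemma bernoulli_inv_degree (i0 : I) (J : {set I}) (theta : R) :
  i0 \notin J -> (forall j, j \in J -> theta <= p j) ->
  theta * #|J|%:R *
    (\sum_f bernoulli_weight f *
       ((f i0)%:R * (1 + \sum_(j in J) (f j : nat))%N%:R^-1)) <= p i0.
Proof.
move=> i0J Jp.
pose Sj j (f : {ffun I -> bool}) := (\sum_(i in J | i != j) (f i : nat))%N.
have SE j (f : {ffun I -> bool}) : j \in J ->
    (\sum_(i in J) (f i : nat) = f j + Sj j f)%N.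
  by move=> jJ; rewrite (bigD1 j).
have Sflip i j f : (i == j) || (i \notin J) -> Sj j (flip_at i f) = Sj j f.
  move=> ij; apply: eq_bigr => l /andP[lJ lj]; rewrite ffunE.
  case: eqVneq => // li; move: ij; rewrite -li lJ orbF => /eqP ij.
  by rewrite ij eqxx in lj.
pose E (g : {ffun I -> bool} -> R) := \sum_f bernoulli_weight f * g f.
have Ele g h : (forall f, g f <= h f) -> E g <= E h.
  by move=> gh; apply: ler_sum => f _; rewrite ler_wpM2l// bernoulli_weight_ge0.
have key : \sum_(j in J) E (fun f => (f i0)%:R * ((f j)%:R / (1 + Sj j f)%N%:R))
    <= p i0.
  rewrite /E exchange_big/= -[leRHS]mulr1.
  have -> : p i0 * 1 = E (fun f => (f i0)%:R * 1).
    rewrite /E bernoulli_indep//.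
    by under eq_bigr do rewrite mulr1; rewrite bernoulli_weight_sum.
  apply: ler_sum => f _; rewrite -mulr_sumr ler_wpM2l ?bernoulli_weight_ge0//.
  rewrite -mulr_sumr ler_wpM2l ?ler0n//.
  have [S0|S0] := eqVneq (\sum_(i in J) (f i : nat))%N 0%N.
    rewrite big1 ?ler01// => j jJ; move: S0; rewrite (SE j)//.
    by case: (f j) => //=; rewrite mul0r.
  rewrite (eq_bigr (fun j => (f j)%:R / (\sum_(i in J) (f i : nat))%N%:R)).
    rewrite -mulr_suml -natr_sum mulfV// pnatr_eq0//.
  by move=> j jJ; rewrite [in RHS](SE j)//; case: (f j); rewrite ?mul0r.
apply: le_trans key; rewrite -/(E (fun f => (f i0)%:R *
  (1 + \sum_(j in J) (f j : nat))%N%:R^-1)).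
rewrite mulrAC mulr_natr -sumr_const; apply: ler_sum => j jJ.
have -> : E (fun f => (f i0)%:R * ((f j)%:R / (1 + Sj j f)%N%:R)) =
          p j * E (fun f => (f i0)%:R / (1 + Sj j f)%N%:R).
  rewrite /E -bernoulli_indep.
    by apply: eq_bigr => f _; congr (_ * _); rewrite mulrCA.
  move=> f; rewrite Sflip ?eqxx// ffunE; case: eqVneq => // ij.
  by rewrite ij jJ in i0J.
have E0 : 0 <= E (fun f => (f i0)%:R / (1 + Sj j f)%N%:R).
  by apply: sumr_ge0 => f _; rewrite !mulr_ge0 ?bernoulli_weight_ge0.
(* Two losses: theta <= p_j here, and then 1 + S >= 1 + S_j inside the expectation. *)
apply: (@le_trans _ _ (p j * E (fun f => (f i0)%:R *
  (1 + \sum_(j0 in J) (f j0 : nat))%N%:R^-1))).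
  rewrite ler_wpM2r ?Jp//.
  by apply: sumr_ge0 => f _; rewrite !mulr_ge0 ?bernoulli_weight_ge0.
have /andP[pj0 _] := p01 j.
apply: ler_wpM2l => //; apply: Ele => f; apply: ler_wpM2l => //.
by rewrite lef_pV2 ?posrE ?ltr0n// ler_nat (SE j)// leq_add2l leq_addl.
Qed.

(** Covers empty [J], the case of a vertex with no other suitable vertex in its cell: the inverse is
    then 1 and theta <= 1 suffices. The count becomes [maxn 1 #|J|], by which one may divide. *)
Lemma bernoulli_inv_degree_maxn (i0 : I) (J : {set I}) (theta : R) :
  theta <= 1 -> i0 \notin J -> (forall j, j \in J -> theta <= p j) ->
  theta * (maxn 1 #|J|)%:R *
    (\sum_f bernoulli_weight f *
       ((f i0)%:R * (1 + \sum_(j in J) (f j : nat))%N%:R^-1)) <= p i0.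
Proof.
move=> t1 i0J Jp; have [J0|J0] := posnP #|J|; last first.
  by rewrite (maxn_idPr J0); exact: bernoulli_inv_degree.
rewrite J0 mulr1; move/cards0_eq : J0 => ->.
under eq_bigr do rewrite big_set0 invr1.
rewrite bernoulli_indep//; under eq_bigr do rewrite mulr1.
rewrite bernoulli_weight_sum mulr1 ler_piMl//.
by have /andP[] := p01 i0.
Qed.

End bernoulli.

(** * Real-valued probabilities *)

Section real_probability.
Context disp (T : measurableType disp) (R : realType) (P : probability T R).
Implicit Types A B : set T.

Definition pr A : R := fine (P A).

Lemma prE A : measurable A -> P A = (pr A)%:E.
Proof. by move=> mA; rewrite fineK// fin_num_measure. Qed.

Lemma pr_ge0 A : 0 <= pr A.
Proof. exact: fine_ge0. Qed.

Lemma pr_mono A B : measurable A -> measurable B -> A `<=` B -> pr A <= pr B.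
Proof.
by move=> mA mB AB; rewrite -lee_fin -!prE// le_measure ?inE.
Qed.

Lemma pr_le1 A : measurable A -> pr A <= 1.
Proof. by move=> mA; rewrite -lee_fin -prE// probability_le1. Qed.

Lemma pr_setD A B : measurable A -> measurable B -> B `<=` A ->
  pr (A `\` B) = pr A - pr B.
Proof.
move=> mA mB BA; have mD := measurableD mA mB.
have : P A = (P (A `\` B) + P B)%E.
  rewrite -measureU// ?setDUK//; first by rewrite setUC setDUK.
  by rewrite -subset0 => x [[]].
by rewrite !prE// => -[->]; rewrite addrK.
Qed.

Lemma pr_setU A B : measurable A -> measurable B ->
  pr (A `|` B) <= pr A + pr B.
Proof.
move=> mA mB; rewrite -lee_fin EFinD -!prE//; last exact: measurableU.
exact: measureU2.
Qed.

Lemma pr_setC A : measurable A -> pr (~` A) = 1 - pr A.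
Proof.
move=> mA; rewrite -setTD pr_setD//; congr (_ - _).
by rewrite /pr probability_setT.
Qed.

Lemma pr_sum_le (I : eqType) (s : seq I) (C : pred I) (A : set T) (B : I -> set T) :
  uniq s -> measurable A -> (forall i, C i -> measurable (B i)) ->
  (forall i, C i -> B i `<=` A) ->
  (forall i j, C i -> C j -> i != j -> B i `&` B j = set0) ->
  \sum_(i <- s | C i) pr (B i) <= pr A.
Proof.
elim: s C A => [|i s IH] C A /=; first by rewrite big_nil pr_ge0.
move=> /andP[nis us] mA mB BA Bd; rewrite big_cons; case: ifP => Ci; last exact: IH.
have mAB := measurableD mA (mB _ Ci).
rewrite -lerBrDl -pr_setD//; [|exact: mB|exact: BA].
rewrite big_seq_cond (eq_bigl (fun j => (j \in s) && (C j && (j != i)))); last first.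
  move=> j; case: (boolP (j \in s)) => //= js; case: (C j) => //=.
  by apply/esym/negP => /eqP ji; rewrite -ji js in nis.
rewrite -big_seq_cond.
apply: IH => // [j /andP[Cj _]|j /andP[Cj ji] x Bx|j k /andP[Cj _] /andP[Ck _]].
- exact: mB.
- split; first exact: BA Bx.
  by move=> Bix; have := Bd _ _ Cj Ci ji; rewrite -subset0; apply; split; eauto.
- exact: Bd.
Qed.

Lemma pr_cover_le (I : eqType) (s : seq I) (C : pred I) (A : set T) (B : I -> set T) :
  measurable A -> (forall i, C i -> measurable (B i)) ->
  (forall x, A x -> exists i, [/\ i \in s, C i & B i x]) ->
  pr A <= \sum_(i <- s | C i) pr (B i).
Proof.
elim: s A => [|i s IH] A mA mB AB.
  rewrite big_nil (_ : A = set0) ?/pr ?measure0//.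
  by rewrite -subset0 => x /AB[j []].
rewrite big_cons; case: ifPn => [Ci|nCi]; last first.
  apply: IH => // x /AB[j [jis Cj Bj]]; exists j; split => //.
  by move: jis; rewrite inE => /orP[/eqP ji|//]; rewrite -ji Cj in nCi.
have mAB := measurableD mA (mB _ Ci).
apply: (@le_trans _ _ (pr (B i) + pr (A `\` B i))).
  apply: le_trans (pr_setU _ _) => //; last exact: mB.
  apply: pr_mono => //; first by apply: measurableU => //; exact: mB.
  by move=> x Ax; have [|] := pselect (B i x); [left|right].
rewrite lerD2l; apply: IH => // x [Ax nBx].
have [j [jis Cj Bj]] := AB _ Ax; exists j; split => //.
by move: jis; rewrite inE => /orP[/eqP ji|//]; rewrite -ji in nBx.
Qed.

Lemma pr_partition (I : finType) (A : set T) (X : T -> I) :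
  measurable A -> (forall i, measurable (A `&` X @^-1` [set i])) ->
  pr A = \sum_i pr (A `&` X @^-1` [set i]).
Proof.
move=> mA mX; apply/eqP; rewrite eq_le; apply/andP; split.
  by apply: pr_cover_le => // x Ax; exists (X x).
apply: pr_sum_le => //; first exact: index_enum_uniq.
move=> i j _ _ ij; rewrite -subset0 => x [[_ /= Xi] [_ /= Xj]].
by rewrite -Xi -Xj eqxx in ij.
Qed.

End real_probability.

(** * Measurability of finitely indexed events *)

Section measurable_sets.
Context disp (T : measurableType disp).

Lemma measurable_forall (I : finType) (C : pred I) (B : I -> set T) :
  (forall i, C i -> measurable (B i)) ->
  measurable [set w | forall i, C i -> B i w].
Proof.
move=> mB; rewrite (_ : mkset _ = \bigcap_(i in [set i | C i]) B i)//.
by apply: fin_bigcap_measurable => //; exact: finite_finset.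
Qed.

Lemma measurable_forallT (I : finType) (B : I -> set T) :
  (forall i, measurable (B i)) -> measurable [set w | forall i, B i w].
Proof.
move=> mB; rewrite (_ : mkset _ = \bigcap_(i in [set: I]) B i).
  by apply: fin_bigcap_measurable => //; exact: finite_finset.
by apply/seteqP; split => w Bw i //; exact: Bw.
Qed.

Lemma measurable_existsT (I : finType) (B : I -> set T) :
  (forall i, measurable (B i)) -> measurable [set w | exists i, B i w].
Proof.
move=> mB; rewrite (_ : mkset _ = ~` [set w | forall i, (~` B i) w]).
  apply: measurableC; apply: (measurable_forallT (B := fun i => ~` B i)) => i.
  exact: measurableC.
apply/seteqP; split=> w /=; first by move=> [i Bw] nB; exact: (nB i).
by move=> /existsNP[i /contrapT Bw]; exists i.
Qed.

Lemma measurable_preim dU (U : measurableType dU) (f : T -> U) (B : set U) :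
  measurable_fun setT f -> measurable B -> measurable [set w | B (f w)].
Proof. by move=> mf mB; rewrite -[mkset _]setTI; exact: mf. Qed.

Lemma measurable_fin_preim (J : finType) (X : T -> J) (S : set J) :
  (forall j, measurable (X @^-1` [set j])) -> measurable (X @^-1` S).
Proof.
move=> mX; rewrite (_ : _ @^-1` _ =
    [set w | exists j, ([set w | S j] `&` X @^-1` [set j]) w]).
  apply: (measurable_existsT (B := fun j => [set w | S j] `&` X @^-1` [set j])) => j.
  apply: measurableI => //; have [Sj|nS] := pselect (S j).
    by rewrite [X in measurable X](_ : _ = setT)//; apply/seteqP; split.
  by rewrite [X in measurable X](_ : _ = set0)//; apply/seteqP; split.
apply/seteqP; split=> [w Sw|w [j [Sj /= Xj]]]; first by exists (X w).
by rewrite /preimage /= Xj.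
Qed.

End measurable_sets.

(** * Measurable events of the model *)

(** Read [F x] as a law on the values allowed by [Q x] and the product as independent choices: the
    sum is the probability that the choice at [x0] avoids [y0]. The restriction concerns each
    coordinate separately, so distributivity leaves a product in which every factor but the one at
    [x0] is 1. *)
Lemma sum_prod_avoid (R : comNzRingType) (X Y : finType) (Q : X -> pred Y)
    (F : X -> Y -> R) (x0 : X) (y0 : Y) :
  (forall x, \sum_(y | Q x y) F x y = 1) ->
  \sum_(h : {ffun X -> Y} | (h \in family Q) && (h x0 != y0)) \prod_x F x (h x) =
  1 - (if Q x0 y0 then F x0 y0 else 0).
Proof.
move=> F1; pose Q' x : pred Y := [pred y | Q x y & (x == x0) ==> (y != y0)].
rewrite (eq_bigl (mem (family Q'))); last first.
  move=> h; apply/andP/familyP => [[/familyP hQ h0] x|hQ].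
    by rewrite !inE; apply/andP; split; [exact: hQ|apply/implyP => /eqP ->].
  split; first by apply/familyP => x; have := hQ x; rewrite !inE => /andP[].
  by have := hQ x0; rewrite !inE eqxx => /andP[].
rewrite -bigA_distr_big_dep (bigD1 x0)//= [X in _ * X]big1 ?mulr1; last first.
  move=> x /negbTE xx0; rewrite -(F1 x); apply: eq_bigl => y.
  by rewrite /Q' /= xx0 andbT.
rewrite -(F1 x0); case: ifP => Q0; last first.
  rewrite subr0; apply: eq_bigl => y; rewrite /Q' /= eqxx/=.
  by case: eqVneq => [->|]; rewrite ?Q0 ?andbT.
rewrite [in RHS](bigD1 y0)//= addrC addrK; apply: eq_bigl => y.
by rewrite /Q' /= eqxx.
Qed.

Section girg_events.
Context (R : realType) (d n : nat) (alpha theta1 theta2 : R).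
Context (D : probability R R) (disp : measure_display).
Context (Omega : measurableType disp) (P : probability Omega R).
Variables (G : girg d n alpha theta1 theta2 D P) (Q : push_pull G).
Local Notation pr := (pr P).

Lemma measurable_preim_discrete (X : {RV P >-> nat}) (B : set nat) :
  measurable (X @^-1` B).
Proof. by rewrite -[X in measurable X]setTI; exact: measurable_funPT. Qed.

Lemma measurable_preim_bool (X : {RV P >-> bool}) (B : set bool) :
  measurable (X @^-1` B).
Proof. by rewrite -[X in measurable X]setTI; exact: measurable_funPT. Qed.

Lemma measurable_num_vertices k : measurable [set w | num_vertices G w = k].
Proof. exact: (measurable_preim_discrete _ [set k]). Qed.

Lemma measurable_edge i j b : measurable [set w | edge G i j w = b].
Proof. exact: (measurable_preim_bool _ [set b]). Qed.

Lemma measurable_start s : measurable [set w | start Q w = s].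
Proof. exact: (measurable_preim_discrete _ [set s]). Qed.

Lemma measurable_call r v x : measurable [set w | call Q r v w = x].
Proof. exact: (measurable_preim_discrete _ [set x]). Qed.

Lemma measurable_positions k : measurable_fun setT (positions G k).
Proof.
apply/measurable_fun_tnthP => i.
rewrite (_ : _ \o _ = position G i); first exact: measurable_funPT.
by apply/funext => w /=; rewrite tnth_mktuple.
Qed.

Lemma measurable_marks k : measurable_fun setT (marks G k).
Proof.
apply/measurable_fun_tnthP => i.
rewrite (_ : _ \o _ = fun w => (position G i w, weight G i w)).
  by apply: measurable_fun_pair; exact: measurable_funPT.
by apply/funext => w /=; rewrite tnth_mktuple.
Qed.

Lemma measurable_marks_preim k A : measurable A -> measurable [set w | A (marks G k w)].
Proof.
by move=> mA; have := @measurable_marks k measurableT A mA; rewrite setTI.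
Qed.

Lemma measurable_positions_preim k A :
  measurable A -> measurable [set w | A (positions G k w)].
Proof.
by move=> mA; have := @measurable_positions k measurableT A mA; rewrite setTI.
Qed.

End girg_events.

(** * The probability of a call *)

Section call_probability.
Context (R : realType) (d n : nat) (alpha theta1 theta2 : R).
Context (D : probability R R) (disp : measure_display).
Context (Omega : measurableType disp) (P : probability Omega R).
Variables (G : girg d n alpha theta1 theta2 D P) (Q : push_pull G).
Local Notation pr := (pr P).

Lemma measurable_graph k (e : rel 'I_k) :
  measurable [set w | forall i j : 'I_k, edge G i j w = e i j].
Proof.
apply: (measurable_forallT
  (B := fun i : 'I_k => [set w | forall j : 'I_k, edge G i j w = e i j])) => i.
apply: (measurable_forallT (B := fun j : 'I_k => [set w | edge G i j w = e i j])) => j.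
exact: measurable_edge.
Qed.

Definition graph_event k (A : set (k.-tuple (d.-tuple R * R))) (e : rel 'I_k) :=
  [set w | [/\ num_vertices G w = k, A (marks G k w) &
              forall i j : 'I_k, edge G i j w = e i j]].

Lemma measurable_graph_event k (A : set (k.-tuple (d.-tuple R * R))) e :
  measurable A -> measurable (graph_event A e).
Proof.
move=> mA.
rewrite (_ : graph_event A e =
  [set w | num_vertices G w = k] `&` [set w | A (marks G k w)]
     `&` [set w | forall i j : 'I_k, edge G i j w = e i j]); last first.
  by apply/seteqP; split=> w; [case|move=> [[]]].
apply: measurableI (measurable_graph _).
exact: measurableI (measurable_num_vertices _ _) (measurable_marks_preim _ mA).
Qed.

(* call_law prescribes the joint law of all calls; the probabilities of the call
   histories in which u calls another vertex add up to 1 - 1/deg u, which leaves at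
   most 1/deg u. *)
Lemma pr_call_start k (A : set (k.-tuple (d.-tuple R * R))) (e : rel 'I_k)
    (s r : nat) (u v : 'I_k) :
  measurable A -> (0 < degree e u)%N ->
  pr (graph_event A e `&` [set w | start Q w = s] `&`
      [set w | call Q r u w = v]) <=
  pr (graph_event A e `&` [set w | start Q w = s]) / (degree e u)%:R.
Proof.
move=> mA u0; have mE := measurableI _ _ (measurable_graph_event e mA)
  (measurable_start Q s).
have EE : graph_event A e `&` [set w | start Q w = s] =
    [set w | [/\ num_vertices G w = k, A (marks G k w),
              forall i j : 'I_k, edge G i j w = e i j & start Q w = s]].
  by apply/seteqP; split=> w; [case=> -[]|case].
set E := graph_event A e `&` _ in mE EE *.
pose H := {ffun 'I_r.+1 * 'I_k -> 'I_k}.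
pose hh (h : H) (q : nat) (x : 'I_k) : 'I_k := h (inord q, x).
(* [call_law] says nothing about isolated vertices. Their entries are pinned to the vertex itself,
   with weight 1 in [om]; otherwise histories that differ only there would describe the same event
   and disjointness would fail. *)
pose F (x : 'I_r.+1 * 'I_k) : pred 'I_k :=
  if (0 < degree e x.2)%N then [pred y | e x.2 y] else pred1 x.2.
pose om (x : 'I_r.+1 * 'I_k) (y : 'I_k) : R :=
  if (0 < degree e x.2)%N then if e x.2 y then (degree e x.2)%:R^-1 else 0 else 1.
pose C (h : H) := [set w | forall (q : nat) (x : 'I_k), (q < r.+1)%N ->
   (0 < degree e x)%N -> call Q q x w = hh h q x].
have PC h : pr (E `&` C h) = pr E * \prod_x om x (h x).
  rewrite /pr [X in X `&` _]EE call_law// -EE prE// -EFinM/=; congr (_ * _).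
  rewrite pair_big_dep/= big_mkcond/=.
  rewrite [LHS]big_mkcond/=; apply: eq_bigr => -[q x] _ /=.
  by rewrite /om/= /hh inord_val.
have mC h : measurable (C h).
  rewrite (_ : C h = [set w | forall x : 'I_r.+1 * 'I_k, (0 < degree e x.2)%N ->
      call Q x.1 x.2 w = h x]).
    apply: (@measurable_forall _ _ _ (fun x : 'I_r.+1 * 'I_k => 0 < degree e x.2)%N
      (fun x => [set w | call Q x.1 x.2 w = h x])) => x _.
    exact: measurable_call.
  apply/seteqP; split => w Cw.
    by move=> [q x] /= x0; rewrite Cw// /hh inord_val.
  move=> q x qr x0; have := Cw (inord q, x) x0.
  by rewrite /hh /= inordK.
have mc := measurable_call Q r u v.
have om1 x : \sum_(y | F x y) om x y = 1.
  rewrite /F /om; case: ifPn => [x0|x0]; last by rewrite big_pred1_eq.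
  rewrite (eq_bigr (fun=> (degree e x.2)%:R^-1)); last by move=> y /= ->.
  rewrite sumr_const -[LHS]mulr_natl (_ : #|_| = degree e x.2).
    by rewrite mulfV// pnatr_eq0 -lt0n.
  by apply: eq_card => y; rewrite !inE.
have avoid := sum_prod_avoid (inord r, u) v om1.
(* A sum over disjoint histories bounds a probability from below without any proof that the
   histories exhaust the event. Passing to the complement turns this into the upper bound. *)
rewrite (_ : E `&` [set w | call Q r u w = v] =
  E `\` (E `\` [set w | call Q r u w = v])); last first.
  apply/seteqP; split=> w [Ew]; first by move=> cw; split => // -[].
  move=> nw; split => //; apply: contrapT => cw; exact: nw.
rewrite pr_setD; [|exact: mE|exact: measurableD|by move=> w []].
rewrite lerBlDl -lerBlDr.
have sub : \sum_(h : H | (h \in family F) && (h (inord r, u) != v))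
     pr (E `&` C h) <= pr (E `\` [set w | call Q r u w = v]).
  apply: pr_sum_le => //.
  - exact: index_enum_uniq.
  - exact: measurableD.
  - by move=> h _; exact: measurableI.
  - move=> h /andP[_ hv] w [Ew Cw]; split => // cw.
    move: (Cw r u (ltnSn _) u0); rewrite cw /hh => /val_inj vh.
    by rewrite vh eqxx in hv.
  - move=> h h' /andP[/familyP hF _] /andP[/familyP h'F _] hh'.
    rewrite -subset0 => w [[_ Cw] [_ C'w]].
    move/eqP: hh'; apply; apply/ffunP => -[q x].
    have [x0|x0] := ltnP 0 (degree e x).
      apply: val_inj; have := Cw q x (ltn_ord q) x0.
      by rewrite (C'w q x (ltn_ord q) x0) /hh inord_val.
    have := hF (q, x); have := h'F (q, x); rewrite /F/= ltnNge x0 /= !inE.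
    by move=> /eqP -> /eqP ->.
apply: le_trans sub.
under eq_bigr do rewrite PC; rewrite -mulr_sumr avoid.
rewrite mulrBr mulr1 lerB// ler_wpM2l ?pr_ge0// /om /F /= u0 /=.
by case: (e u v).
Qed.

(** [call_law] fixes the start vertex, since it may depend on the graph; summing over its k possible
    values removes it. The default [u] of [insubd] is never taken, because [start_vertex] puts the
    start below k on this event. *)
Lemma pr_call k (A : set (k.-tuple (d.-tuple R * R))) (e : rel 'I_k)
    (r : nat) (u v : 'I_k) :
  measurable A -> (0 < degree e u)%N ->
  pr (graph_event A e `&` [set w | call Q r u w = v]) <=
  pr (graph_event A e) / (degree e u)%:R.
Proof.
move=> mA u0; have mE := measurable_graph_event e mA.
set E := graph_event A e in mE *.
pose S w : 'I_k := insubd u (start Q w).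
have ES s : E `&` S @^-1` [set s] = E `&` [set w | start Q w = s].
  have sk w : num_vertices G w = k -> S w = start Q w :> nat.
    move=> Nk; rewrite /S val_insubd ifT//.
    rewrite -[X in (_ < X)%N]Nk start_vertex// Nk.
    exact: leq_ltn_trans (ltn_ord u).
  apply/seteqP; split=> w /= -[[Nk Aw ew] Sw].
    by split; rewrite -?sk ?Sw.
  by split => //; apply: val_inj; rewrite /= sk.
have mS s : measurable (E `&` S @^-1` [set s]).
  by rewrite ES; exact: measurableI (measurable_start _ _).
have mc := measurable_call Q r u v.
rewrite (@pr_partition _ _ _ _ _ (E `&` _) S); last 2 first.
- exact: measurableI.
- by move=> s; rewrite setIAC; exact: measurableI.
rewrite (pr_partition P mE mS) mulr_suml; apply: ler_sum => s _.
by rewrite setIAC ES; exact: pr_call_start.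
Qed.

End call_probability.

(** * Adjacent vertices and calls *)

Section edge_pairs.
Variable k : nat.

(** One index per unordered pair, matching the i < j of [edge_law]. [to_pair] returns [None] exactly
    on the diagonal, so [graph_of] is symmetric and irreflexive by construction. *)
Definition edge_pair := {x : 'I_k * 'I_k | (x.1 < x.2)%N}.

Definition to_pair (i j : 'I_k) : option edge_pair :=
  if insub (i, j) is Some p then Some p else insub (j, i).

Definition graph_of (f : {ffun edge_pair -> bool}) : rel 'I_k :=
  fun i j => oapp f false (to_pair i j).

Lemma to_pairP i j : i != j ->
  exists2 p, to_pair i j = Some p & val p = (i, j) \/ val p = (j, i).
Proof.
rewrite /to_pair neq_ltn => /orP[ij|ji].
  by exists (Sub (i, j) ij) => /=; [rewrite insubT|left].
exists (Sub (j, i) ji) => /=; last by right.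
by rewrite insubN ?insubT//= -leqNgt ltnW.
Qed.

Lemma to_pair_val (p : edge_pair) : to_pair (val p).1 (val p).2 = Some p.
Proof. by rewrite /to_pair -surjective_pairing valK. Qed.

Lemma to_pair_sym i j : to_pair i j = to_pair j i.
Proof.
rewrite /to_pair; case: insubP => [p ij vp|]; case: insubP => [q ji vq|] //.
  by exfalso; move: ij ji => /= /ltnW ij; rewrite ltnNge ij.
Qed.

Lemma to_pairxx i : to_pair i i = None.
Proof. by rewrite /to_pair !insubN//= ltnn. Qed.

End edge_pairs.

Lemma circle_distC (R : realType) (a b : R) : circle_dist a b = circle_dist b a.
Proof. by rewrite /circle_dist distrC. Qed.

Lemma torus_distC (R : realType) d (x y : d.-tuple R) : torus_dist x y = torus_dist y x.
Proof. by apply: eq_bigr => i _; rewrite circle_distC. Qed.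

Section edge_weight_facts.
Context (R : realType) (d n : nat) (alpha : R).
Implicit Types u v : d.-tuple R * R.

Lemma edge_weightC u v : edge_weight n alpha u v = edge_weight n alpha v u.
Proof. by rewrite /edge_weight torus_distC (mulrC u.2). Qed.

Lemma edge_weight_ge0 u v : 0 <= edge_weight n alpha u v.
Proof.
rewrite /edge_weight; case: ifP => // _.
by rewrite le_min ler01 andbT powR_ge0.
Qed.

Lemma edge_weight_le1 u v : edge_weight n alpha u v <= 1.
Proof. by rewrite /edge_weight; case: ifP => // _; rewrite ge_min lexx orbT. Qed.

End edge_weight_facts.

Section edge_probability.
Context (R : realType) (d n : nat) (alpha theta1 theta2 : R).
Context (D : probability R R) (disp : measure_display).
Context (Omega : measurableType disp) (P : probability Omega R).
Variables (G : girg d n alpha theta1 theta2 D P) (Q : push_pull G).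
Local Notation pr := (pr P).
Hypotheses (theta1_gt0 : 0 < theta1) (theta12 : theta1 <= theta2)
  (theta2_le1 : theta2 <= 1).

Definition mark_event k (A : set (k.-tuple (d.-tuple R * R))) :=
  [set w | num_vertices G w = k /\ A (marks G k w)].

Lemma measurable_mark_event k (A : set (k.-tuple (d.-tuple R * R))) :
  measurable A -> measurable (mark_event A).
Proof.
by move=> mA; exact: measurableI (measurable_num_vertices _ _) (measurable_marks_preim _ mA).
Qed.

Definition edges k (w : Omega) : {ffun edge_pair k -> bool} :=
  [ffun p : edge_pair k => edge G (val p).1 (val p).2 w].

Lemma edgesP k w f :
  edges k w = f <-> forall i j : 'I_k, edge G i j w = graph_of f i j.
Proof.
split=> [<- i j|ef].
  rewrite /graph_of; have [<-|ij] := eqVneq i j.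
    by rewrite to_pairxx edge_irr.
  have [p -> [] vp /=] := to_pairP ij; rewrite ffunE vp//=.
  by rewrite edge_sym.
by apply/ffunP => p; rewrite ffunE ef /graph_of to_pair_val.
Qed.

Definition pair_prob k (z : k.-tuple (d.-tuple R * R)) (p : edge_pair k) : R :=
  edge_prob G z (val p).1 (val p).2.

Lemma graph_eventE k (A : set (k.-tuple (d.-tuple R * R))) f :
  graph_event G A (graph_of f) = mark_event A `&` edges k @^-1` [set f].
Proof.
apply/seteqP; split=> w.
  by move=> [Nk Aw ew]; split => //; apply/edgesP.
by move=> [[Nk Aw] /edgesP ef].
Qed.

(** Identifies the law of the graph given the marks with the product weight studied above.
    [edge_law] constrains only i < j; symmetry and irreflexivity of [edge] settle the remaining
    pairs. *)
Lemma graph_event_law k (A : set (k.-tuple (d.-tuple R * R))) f :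
  measurable A ->
  P (graph_event G A (graph_of f)) =
  (\int[P]_(w in mark_event A) (bernoulli_weight (pair_prob (marks G k w)) f)%:E)%E.
Proof.
move=> mA.
rewrite (_ : graph_event _ _ _ = [set w | [/\ num_vertices G w = k, A (marks G k w) &
    forall i j : 'I_k, (i < j)%N -> edge G i j w = graph_of f i j]]).
  rewrite edge_law//; apply: eq_integral => w _; congr (_%:E).
  rewrite pair_big_dep/= /bernoulli_weight.
  rewrite (reindex_omap (val : edge_pair k -> _) insub); last first.
    by move=> x ltx; rewrite insubT.
  apply: eq_big => [x|x _]; first by rewrite valK eqxx (valP x).
  by rewrite /graph_of to_pair_val.
apply/seteqP; split=> w [Nk Aw ew]; split => // i j.
have [<-|] := eqVneq i j; first by rewrite edge_irr /graph_of to_pairxx.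
rewrite neq_ltn => /orP[ij|ji]; first exact: ew.
by rewrite edge_sym ew// /graph_of to_pair_sym.
Qed.
Definition valid_marks k (z : k.-tuple (d.-tuple R * R)) :=
  forall l, @torus R d (tnth z l).1 /\ 1 <= (tnth z l).2.

Lemma pair_prob_bounds k (z : k.-tuple (d.-tuple R * R)) (i j : 'I_k) p :
  valid_marks z -> to_pair i j = Some p ->
  theta1 * edge_weight n alpha (tnth z i) (tnth z j) <= pair_prob z p
    <= theta2 * edge_weight n alpha (tnth z i) (tnth z j).
Proof.
move=> vz ijp; have ij : i != j.
  by apply/eqP => ij; move: ijp; rewrite ij to_pairxx.
have [q] := to_pairP ij; rewrite ijp => -[<-] vp.
have := @edge_prob_bounds _ _ _ _ _ _ _ _ _ _ G k z _ _ vz (valP p).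
by rewrite /pair_prob; case: vp => ->; [exact|rewrite (edge_weightC _ _ (tnth z i)); exact].
Qed.

Lemma pair_prob01 k (z : k.-tuple (d.-tuple R * R)) p :
  valid_marks z -> 0 <= pair_prob z p <= 1.
Proof.
move=> vz; have /andP[l r] := pair_prob_bounds vz (to_pair_val p).
rewrite (le_trans _ l) ?mulr_ge0 ?edge_weight_ge0 ?(ltW theta1_gt0)//=.
apply: (le_trans r); apply: mulr_ile1 => //; first last.
- exact: edge_weight_le1.
- exact: edge_weight_ge0.
- by rewrite (le_trans (ltW theta1_gt0)).
Qed.

Lemma measurable_bernoulli_weight k f :
  measurable_fun setT (fun w => bernoulli_weight (pair_prob (marks G k w)) f).
Proof.
apply: measurable_prod => p _; case: (f p).
  apply: (measurableT_comp (f := fun z => edge_prob G z (val p).1 (val p).2)).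
    exact: edge_prob_measurable.
  exact: measurable_marks.
apply: measurable_funB => //.
apply: (measurableT_comp (f := fun z => edge_prob G z (val p).1 (val p).2)).
  exact: edge_prob_measurable.
exact: measurable_marks.
Qed.

(* Given the marks, the chance that u and v are adjacent and u calls v is
   E[f_uv / deg u], which bernoulli_inv_degree_maxn bounds by p_uv divided by
   theta1 times the number of vertices close to u. *)
Lemma pr_edge_call k (A : set (k.-tuple (d.-tuple R * R))) (u v : 'I_k)
    (U : {set 'I_k}) (r : nat) (pbar : R) :
  measurable A -> (forall z, A z -> valid_marks z) ->
  u != v -> u \notin U -> v \notin U ->
  (forall z, A z -> edge_weight n alpha (tnth z u) (tnth z v) <= pbar) ->
  (forall z x, A z -> x \in U -> 1 <= edge_weight n alpha (tnth z u) (tnth z x)) ->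
  theta1 * (maxn 1 #|U|)%:R *
    pr (mark_event A `&` [set w | edge G u v w = true] `&`
        [set w | call Q r u w = v]) <= theta2 * pbar * pr (mark_event A).
Proof.
move=> mA vA uv uU vU Apb AU.
have [p0 uvp0 _] := to_pairP uv.
pose J := [set odflt p0 (to_pair u x) | x in U]%SET.
have pU x : x \in U -> exists2 p, to_pair u x = Some p & val p = (u, x) \/ val p = (x, u).
  by move=> xU; apply: to_pairP; apply: contraNneq uU => ->.
have pairI x y (p : edge_pair k) : val p = (u, x) \/ val p = (x, u) ->
    val p = (u, y) \/ val p = (y, u) -> x = y.
  by move=> [] -> [] [] -> //; move=> ->.
have injU : {in U &, injective (fun x => odflt p0 (to_pair u x))}.
  move=> x y /pU[p -> vp] /pU[q -> vq] /= pq.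
  by rewrite -pq in vq; exact: pairI vp vq.
have cJ : #|J| = #|U| by exact: card_in_imset.
have p0J : p0 \notin J.
  apply/imsetP => -[x xU]; have [p -> vp] := pU x xU; move=> /= pp0.
  have [q] := to_pairP uv; rewrite uvp0 => -[<-] vq.
  by rewrite pp0 in vq; rewrite (pairI _ _ _ vq vp) xU in vU.
pose c (f : {ffun edge_pair k -> bool}) : R :=
  (f p0)%:R * (1 + \sum_(j in J) (f j : nat))%N%:R^-1.
have c0 f : 0 <= c f by rewrite mulr_ge0.
set E0 := mark_event A.
have mE0 : measurable E0 by exact: measurable_mark_event.
have mE : measurable [set w | edge G u v w = true] by exact: measurable_edge.
have mc : measurable [set w | call Q r u w = v] by exact: measurable_call.
have mGE f : measurable (E0 `&` edges k @^-1` [set f]).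
  by rewrite -graph_eventE; exact: measurable_graph_event.
set E1 := E0 `&` _ `&` _.
have mE1 : measurable E1 by apply: measurableI => //; exact: measurableI.
have E1X f : E1 `&` edges k @^-1` [set f] =
    E0 `&` edges k @^-1` [set f] `&` [set w | edge G u v w = true] `&`
    [set w | call Q r u w = v].
  by rewrite /E1 setIAC; congr (_ `&` _); rewrite setIAC.
have mE1X f : measurable (E1 `&` edges k @^-1` [set f]).
  by rewrite E1X; apply: measurableI => //; exact: measurableI.
have step1 : pr E1 <= \sum_f c f * pr (E0 `&` edges k @^-1` [set f]).
  rewrite (pr_partition P mE1 mE1X); apply: ler_sum => f _; rewrite E1X.
  case: (boolP (graph_of f u v)) => fuv; last first.
    rewrite (_ : _ `&` [set w | call Q r u w = v] = set0); last first.
      rewrite -subset0 => w [[[_ /edgesP ef] /= euv] _].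
      by rewrite -ef euv in fuv.
    by rewrite /pr measure0 mulr_ge0// pr_ge0.
  (* The 1 counts [v], which is a neighbour of [u] outside [U]. *)
  have deg : (1 + \sum_(j in J) (f j : nat) <= degree (graph_of f) u)%N.
    rewrite /J big_imset//= (eq_bigr (fun x => (graph_of f u x : nat))); last first.
      by move=> x /pU[p]; rewrite /graph_of => ->.
    rewrite -big_mkcondr/= sum1_card.
    pose B := [set x in U | graph_of f u x]%SET.
    rewrite (_ : #|_| = #|B|); last by apply: eq_card => x; rewrite !inE.
    have vB : v \notin B by rewrite inE (negbTE vU).
    have -> : (1 + #|B|)%N = #|(v |: B)%SET| by rewrite cardsU1 vB.
    apply: subset_leq_card; apply/fintype.subsetP => x.
    by rewrite !inE => /orP[/eqP ->|/andP[]].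
  have d0 : (0 < degree (graph_of f) u)%N by apply: leq_trans deg.
  rewrite -graph_eventE.
  apply: (@le_trans _ _ (pr (graph_event G A (graph_of f) `&` [set w | call Q r u w = v]))).
    apply: pr_mono.
    - by rewrite graph_eventE; apply: measurableI => //; exact: measurableI.
    - by rewrite graph_eventE; apply: measurableI => //; exact: measurableI.
    - by move=> w [[? ?] ?].
  apply: le_trans (pr_call Q r v mA d0) _.
  rewrite mulrC ler_wpM2r ?pr_ge0// /c.
  move: fuv; rewrite /graph_of uvp0 /= => -> /=; rewrite mul1r.
  by rewrite lef_pV2 ?posrE ?ltr0n// ler_nat.
set M := theta1 * (maxn 1 #|U|)%:R.
have M0 : 0 < M by rewrite mulr_gt0// ltr0n leq_max.
pose K := theta2 * pbar / M.
have t20 : 0 <= theta2 by rewrite (le_trans (ltW theta1_gt0)).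
rewrite mulrC -ler_pdivlMr// mulrAC -/K; apply: (le_trans step1).
(* The sign of [pbar] is known only once some mark vector lies in [A]; an empty event is therefore
   treated apart. *)
have [E00|] := pselect (E0 = set0).
  rewrite E00; under eq_bigr do rewrite set0I /pr measure0 mulr0.
  by rewrite big1// /pr measure0 mulr0.
move=> /eqP/set0P[w0 [_ Aw0]].
have K0 : 0 <= K.
  rewrite divr_ge0 ?(ltW M0)// mulr_ge0//.
  by apply: le_trans (Apb _ Aw0); exact: edge_weight_ge0.
have Kb w : E0 w ->
    \sum_f c f * bernoulli_weight (pair_prob (marks G k w)) f <= K.
  move=> [Nk Aw]; rewrite /K ler_pdivlMr// mulrC.
  under eq_bigr do rewrite mulrC.
  apply: (@le_trans _ _ (pair_prob (marks G k w) p0)).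
    rewrite /M -cJ; apply: bernoulli_inv_degree_maxn => //.
    - by move=> p; apply: pair_prob01; exact: vA.
    - exact: le_trans theta2_le1.
    - move=> p /imsetP[x xU ->]; have [q uxq vq] := pU x xU; rewrite uxq /=.
      have /andP[+ _] := pair_prob_bounds (vA _ Aw) uxq.
      apply: le_trans; rewrite ler_peMr ?(ltW theta1_gt0)//.
      exact: AU.
  have /andP[_ +] := pair_prob_bounds (vA _ Aw) uvp0.
  by move=> /le_trans; apply; rewrite ler_wpM2l// Apb.
have b0 w f : E0 w -> 0 <= bernoulli_weight (pair_prob (marks G k w)) f.
  by move=> [_ Aw]; apply: bernoulli_weight_ge0 => p; apply: pair_prob01; exact: vA.
have mb f : measurable_fun E0 (fun w => bernoulli_weight (pair_prob (marks G k w)) f).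
  exact: measurable_funTS (measurable_bernoulli_weight f).
rewrite -lee_fin EFinM -[in leRHS]prE// -sumEFin.
under eq_bigr do rewrite EFinM -prE// -graph_eventE graph_event_law//.
under eq_bigr => f _.
  rewrite -ge0_integralZl//; last 3 first.
  - exact/measurable_EFinP.
  - by move=> w E0w; rewrite lee_fin b0.
  - by rewrite lee_fin.
  over.
rewrite -ge0_integral_sum//; last 2 first.
- move=> f; apply: measurable_funeM; exact/measurable_EFinP.
- by move=> f w E0w; rewrite mule_ge0 ?lee_fin ?b0.
rewrite -(integral_cst P mE0 K%:E); apply: ge0_le_integral => //.
- by move=> w E0w; apply: sume_ge0 => f _; rewrite mule_ge0 ?lee_fin ?b0.
- apply: emeasurable_sum => f; apply: measurable_funeM; exact/measurable_EFinP.
- by move=> w E0w; rewrite /= sumEFin lee_fin Kb.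
Qed.

End edge_probability.

(** * The torus *)

Section torus_geometry.
Context (R : realType).
Implicit Types (a b c r y g : R).

Lemma circle_dist_triangle a b c : 0 <= a < 1 -> 0 <= b < 1 -> 0 <= c < 1 ->
  circle_dist a c <= circle_dist a b + circle_dist b c.
Proof.
rewrite /circle_dist => /andP[a0 a1] /andP[b0 b1] /andP[c0 c1].
have [h1|h1] := ger0P (a - b); have [h2|h2] := ger0P (b - c);
  have [h3|h3] := ger0P (a - c); rewrite !minEle; do ! case: ifPn; rewrite -?ltNge; lra.
Qed.

Lemma circle_dist_le1 a b : 0 <= a < 1 -> 0 <= b < 1 -> circle_dist a b <= 1.
Proof.
rewrite /circle_dist => /andP[a0 a1] /andP[b0 b1].
by rewrite ge_min ler_norml; apply/orP; left; lra.
Qed.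

Lemma circle_distxx a : circle_dist a a <= 0.
Proof. by rewrite /circle_dist subrr normr0 ge_min lexx. Qed.

End torus_geometry.

(** * Volumes of balls in the torus *)

Section torus_volume.
Context (R : realType).
Implicit Types (a b c r y g : R).

Definition circle_ball g r := [set y | circle_dist y g <= r].

Section dim.
Variable d : nat.
Implicit Types x z t : d.-tuple R.

Lemma torus_dist_ge0 x t : 0 <= torus_dist x t.
Proof. exact: bigmax_ge_id. Qed.

Lemma torus_dist_le x t r : 0 <= r ->
  (torus_dist x t <= r) <-> (forall i, circle_dist (tnth x i) (tnth t i) <= r).
Proof.
move=> r0; split => [h i|h].
  exact: le_trans (le_bigmax _ (fun i => circle_dist (tnth x i) (tnth t i)) i) h.
by apply: bigmax_le => // i _; exact: h.
Qed.

Lemma circle_dist_le_torus x t i : circle_dist (tnth x i) (tnth t i) <= torus_dist x t.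
Proof. exact: (torus_dist_le x t (torus_dist_ge0 x t)).1. Qed.

Lemma torus_dist_triangle x t z : torus x -> torus t -> torus z ->
  torus_dist x z <= torus_dist x t + torus_dist t z.
Proof.
move=> Tx Tt Tz; apply/torus_dist_le; first by rewrite addr_ge0 ?torus_dist_ge0.
move=> i; apply: (le_trans (circle_dist_triangle (Tx i) (Tt i) (Tz i))).
by apply: lerD; exact: circle_dist_le_torus.
Qed.

Lemma torus_dist_le1 x t : torus x -> torus t -> torus_dist x t <= 1.
Proof.
by move=> Tx Tt; apply/torus_dist_le => // i; exact: circle_dist_le1.
Qed.

Lemma torus_distxx x : torus_dist x x = 0.
Proof.
apply/eqP; rewrite eq_le torus_dist_ge0 andbT; apply/torus_dist_le => // i.
exact: circle_distxx.
Qed.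

Lemma measurable_box (B : 'I_d -> set R) : (forall i, measurable (B i)) ->
  measurable [set x : d.-tuple R | forall i, B i (tnth x i)].
Proof.
move=> mB; apply: (measurable_forallT (B := fun i => [set x : d.-tuple R | B i (tnth x i)])) => i.
by have := @measurable_tnth _ R d i measurableT _ (mB i); rewrite setTI.
Qed.

Lemma measurable_circle_dist dT (T : measurableType dT) (f1 f2 : T -> R) :
  measurable_fun setT f1 -> measurable_fun setT f2 ->
  measurable_fun setT (fun w => circle_dist (f1 w) (f2 w)).
Proof.
move=> mf1 mf2; have mn : measurable_fun setT (fun w => `|f1 w - f2 w|).
  by apply: measurableT_comp => //; exact: measurable_funB.
by apply: measurable_minr => //; exact: measurable_funB.
Qed.

Lemma measurable_circle_ball g r : measurable (circle_ball g r).
Proof.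
rewrite -[circle_ball _ _]setTI; apply: (@measurable_fun_le _ _ _ setT (fun y => circle_dist y g) (cst r)) => //.
exact: measurable_circle_dist.
Qed.

Lemma torus_ballE t r : 0 <= r -> [set x | torus_dist x t <= r] =
  [set x | forall i, circle_ball (tnth t i) r (tnth x i)].
Proof. by move=> r0; apply/seteqP; split=> x; [exact: (torus_dist_le x t r0).1|exact: (torus_dist_le x t r0).2]. Qed.

Lemma measurable_torus_ball t r : 0 <= r -> measurable [set x | torus_dist x t <= r].
Proof.
move=> r0; rewrite torus_ballE//.
apply: (measurable_box (B := fun i => circle_ball (tnth t i) r)) => i.
exact: measurable_circle_ball.
Qed.

End dim.

Local Notation U := (uniform_prob (@ltr01 R)).

Lemma torus_volume_box d (B : 'I_d -> set R) : (forall i, measurable (B i)) ->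
  torus_volume R d [set x : d.-tuple R | forall i, B i (tnth x i)] =
  (\prod_i U (B i))%E.
Proof.
elim: d B => [|d IH] B mB.
  by rewrite big_ord0 /= diracE mem_set// => -[].
rewrite big_ord_recl /= /distribution /pushforward.
rewrite (_ : _ @^-1` _ = B ord0 `*`
    [set x : d.-tuple R | forall i, B (lift ord0 i) (tnth x i)]); last first.
  apply/seteqP; split=> -[y x] /=.
    move=> h; split; first exact: (h ord0).
    by move=> i; have := h (lift ord0 i); rewrite tnthS.
  move=> [By Bx] i; have [j ->|->//] := unliftP ord0 i.
  by rewrite tnthS.
have mB' : measurable [set x : d.-tuple R | forall i, B (lift ord0 i) (tnth x i)].
  exact: (measurable_box (B := fun i => B (lift ord0 i))).
rewrite product_measure1E//; last exact: mB.
congr (_ * _)%E; exact: (IH (fun i => B (lift ord0 i))).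
Qed.

Lemma uniform_le_lebesgue (A : set R) : measurable A -> (U A <= lebesgue_measure A)%E.
Proof.
move=> mA; have := integral_cst (@lebesgue_measure R) mA 1%E; rewrite mul1e => <-.
apply: ge0_le_integral => //.
- by move=> x _; rewrite lee_fin uniform_pdf_ge0.
- by apply/measurable_EFinP; apply: measurable_funTS; exact: measurable_uniform_pdf.
- by move=> x _; rewrite lee_fin /uniform_pdf subr0 invr1; case: ifP.
Qed.

Lemma uniform_itv01 (A : set R) : measurable A -> A `<=` `[0, 1] ->
  U A = lebesgue_measure A.
Proof.
move=> mA A01; have := integral_cst (@lebesgue_measure R) mA 1%E; rewrite mul1e => <-.
apply: eq_integral => x.
rewrite inE => /A01 /=; rewrite in_itv/= => x01.
by rewrite /uniform_pdf x01 subr0 invr1.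
Qed.

(** Inside [0, 1] the arc is covered by three intervals of length 2r, around g and its translates g
    + 1 and g - 1; this is the origin of the 6 in all volume bounds. *)
Lemma uniform_circle_ball g r : 0 <= g < 1 -> 0 <= r ->
  (U (circle_ball g r) <= (6 * r)%:E)%E.
Proof.
move=> /andP[g0 g1] r0.
have -> : U (circle_ball g r) =
          U (circle_ball g r `&` `[0%R, 1%R]).
  exact: integral_uniform_pdf.
pose J (c : R) : set R := `[c - r, c + r]%classic.
have mJ c : measurable (J c) by exact: measurable_itv.
have UJ c : (U (J c) <= (2 * r)%:E)%E.
  apply: (le_trans (uniform_le_lebesgue _)) => //.
  rewrite lebesgue_measure_itv/= lte_fin; case: ifP => _.
    by rewrite -EFinD lee_fin; lra.
  by rewrite lee_fin; lra.
have sub : circle_ball g r `&` `[0%R, 1%R] `<=` J g `|` (J (g + 1) `|` J (g - 1)).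
  move=> y []; rewrite /J /circle_ball /= !in_itv/= /circle_dist ge_min => h /andP[y0 y1].
  have [h1|h1] := ger0P (y - g); rewrite ?(ger0_norm h1) ?(ltr0_norm h1) in h;
    case/orP: h => h; [left|right;left|left|right;right]; apply/andP; split; lra.
have mJ2 := measurableU _ _ (mJ (g + 1)) (mJ (g - 1)).
apply: (@le_trans _ _ (U (J g `|` (J (g + 1)%R `|` J (g - 1)%R)))).
  apply: le_measure; rewrite ?inE; last exact: sub.
    by apply: measurableI; [exact: measurable_circle_ball|exact: measurable_itv].
  exact: measurableU (mJ g) mJ2.
have U2 (A B : set R) : measurable A -> measurable B -> (U (A `|` B) <= U A + U B)%E.
  by move=> mA mB; exact: measureU2.
apply: (le_trans (U2 _ _ (mJ g) mJ2)).
rewrite (_ : 6 * r = 2 * r + (2 * r + 2 * r)); last by lra.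
rewrite 2!EFinD; apply: leeD => //.
by apply: (le_trans (U2 _ _ (mJ _) (mJ _))); apply: leeD.
Qed.

Lemma uniform_circle_ball0 r : 0 <= r <= 1 ->
  (r%:E <= U (circle_ball 0 r))%E.
Proof.
move=> /andP[r0 r1]; apply: (@le_trans _ _ (U `[0, r]%classic)).
  rewrite uniform_itv01//; last first.
    by move=> x /=; rewrite !in_itv/= => /andP[->] /le_trans; apply.
  by rewrite lebesgue_measure_itv/= lte_fin; case: ltgtP r0 => // [_|<-] _; rewrite ?sube0.
apply: le_measure; rewrite ?inE => //; first exact: measurable_circle_ball.
by move=> x; rewrite /circle_ball /= in_itv/= /circle_dist subr0 ge_min => /andP[x0 xr]; rewrite ger0_norm// xr.
Qed.

Lemma lee_prod (I : finType) (f h : I -> \bar R) :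
  (forall i, 0 <= f i <= h i)%E -> (\prod_i f i <= \prod_i h i)%E.
Proof.
move=> fh; suff /andP[] : (0 <= \prod_i f i <= \prod_i h i)%E by [].
elim/big_ind2 : _ => [|x1 x2 y1 y2 /andP[x0 xy] /andP[x0' xy']|i _].
- by rewrite lexx lee01.
- by rewrite mule_ge0//= lee_pmul.
- exact: fh.
Qed.

Lemma torus_ball_volume_le d (t : d.-tuple R) r : torus t -> 0 <= r ->
  (torus_volume R d [set x | (torus_dist x t <= r)%R] <= ((6 * r) ^+ d)%:E)%E.
Proof.
move=> Tt r0; rewrite torus_ballE// (torus_volume_box
  (B := fun i => circle_ball (tnth t i) r)); last first.
  by move=> i; exact: measurable_circle_ball.
rewrite -[d in _ ^+ d]card_ord -prodr_const -prodEFin.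
apply: lee_prod => i; rewrite measure_ge0/=.
exact: uniform_circle_ball.
Qed.

Lemma ball_volume_le d r : 0 <= r -> ball_volume d r <= (6 * r) ^+ d.
Proof.
move=> r0; rewrite -lee_fin /ball_volume fineK; last first.
  by rewrite fin_num_measure//; exact: measurable_torus_ball.
by apply: torus_ball_volume_le => // i; rewrite tnth_mktuple lexx ltr01.
Qed.

Lemma ball_volume_ge d r : 0 <= r <= 1 -> r ^+ d <= ball_volume d r.
Proof.
move=> r01; have r0 : 0 <= r by case/andP: r01.
rewrite -lee_fin /ball_volume fineK; last first.
  by rewrite fin_num_measure//; exact: measurable_torus_ball.
rewrite torus_ballE// (torus_volume_box
  (B := fun i => circle_ball (tnth [tuple 0 | _ < d] i) r)); last first.
  by move=> i; exact: measurable_circle_ball.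
rewrite -[d in _ ^+ d]card_ord -prodr_const -prodEFin.
apply: lee_prod => i; rewrite lee_fin r0/= tnth_mktuple.
exact: uniform_circle_ball0.
Qed.
End torus_volume.

(** * Edge weights of close and far vertices *)

Lemma measurable_torus (R : realType) (d : nat) : measurable (@torus R d).
Proof.
rewrite (_ : @torus R d = [set x | forall i : 'I_d, `[0%R, (1%R : R)[%classic (tnth x i)]).
  by apply: (measurable_box (B := fun=> `[0%R, (1%R : R)[%classic)).
by apply/seteqP; split=> x Tx i; have := Tx i; rewrite /= in_itv.
Qed.

Section edge_weight_bounds.
Context (R : realType) (d n : nat) (alpha : R).
Implicit Types u v : d.-tuple R * R.
Hypothesis (n_gt0 : (0 < n)%N) (alpha_ge0 : 0 <= alpha).

(** The weight of [u] alone beats the volume: W_u W_v >= w >= n V, so the minimum is 1 for any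
    partner of weight at least 1. If V = 0 the value is 1 by convention. *)
Lemma edge_weight_near u v (r w : R) :
  torus_dist u.1 v.1 <= r -> n%:R * (6 * r) ^+ d <= w -> 0 < w ->
  w <= u.2 -> 1 <= v.2 ->
  1 <= edge_weight n alpha u v.
Proof.
move=> tr nw w0 wu v1; rewrite /edge_weight; case: ifPn => // V0.
set t := torus_dist _ _ in tr V0 *.
have t0 : 0 <= t by exact: torus_dist_ge0.
have Vpos : 0 < ball_volume d t by rewrite lt_def V0 fine_ge0.
have Vle : ball_volume d t <= (6 * r) ^+ d.
  apply: (le_trans (ball_volume_le d t0)); apply: lerXn2r; rewrite ?nnegrE; lra.
have nV : 0 < n%:R * ball_volume d t by rewrite mulr_gt0// ltr0n.
have e1 : 1 `^ alpha = 1 :> R by rewrite powR1.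
rewrite le_min lexx andbT -[leLHS]e1.
apply: ge0_ler_powR => //.
- by rewrite nnegrE.
- by rewrite nnegrE divr_ge0 ?(ltW nV)// mulr_ge0//; [exact: le_trans (ltW w0) wu|exact: le_trans v1].
rewrite ler_pdivlMr// mul1r (le_trans _ (_ : w <= _))//.
  by apply: le_trans nw; rewrite ler_wpM2l.
rewrite -[leLHS]mulr1; apply: ler_pM; lra.
Qed.

Lemma edge_weight_far u v (r y beta : R) :
  torus u.1 -> torus v.1 -> 0 < r <= torus_dist u.1 v.1 ->
  0 < beta <= alpha -> 0 <= u.2 * v.2 <= y ->
  edge_weight n alpha u v <= (y / (n%:R * r ^+ d)) `^ beta.
Proof.
move=> Tu Tv /andP[r0 rt] /andP[b0 ba] /andP[uv0 uvy]; rewrite /edge_weight.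
set t := torus_dist _ _ in rt *.
have t01 : 0 <= t <= 1 by rewrite torus_dist_ge0 torus_dist_le1.
have Vge : r ^+ d <= ball_volume d t.
  apply: le_trans (ball_volume_ge d t01).
  by apply: lerXn2r; rewrite ?nnegrE; lra.
have rd : 0 < r ^+ d by rewrite exprn_gt0.
have V0 : 0 < ball_volume d t by exact: lt_le_trans Vge.
rewrite gt_eqF//; set x := _ / _.
have x0 : 0 <= x by rewrite divr_ge0// mulr_ge0// ltW.
apply: (@le_trans _ _ (x `^ beta)).
  rewrite ge_min; have [x1|x1] := leP x 1.
    have [->|xN0] := eqVneq x 0.
      by rewrite !powR0 ?lexx// gt_eqF//; exact: lt_le_trans ba.
    apply/orP; left; rewrite /powR (negbTE xN0) ler_expR.
    by apply: ler_wnM2r => //; apply: ln_le0.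
  have e1 : 1 `^ beta = 1 :> R by rewrite powR1.
  by apply/orP; right; rewrite -[leLHS]e1 ge0_ler_powR ?nnegrE// ?ltW.
apply: ge0_ler_powR; rewrite ?nnegrE ?(ltW b0)//.
  by rewrite divr_ge0 ?(le_trans uv0 uvy)// mulr_ge0// ltW.
rewrite /x; apply: ler_pM => //; first by rewrite invr_ge0 mulr_ge0// ltW.
by rewrite lef_pV2 ?posrE ?mulr_gt0 ?ltr0n// ler_wpM2l.
Qed.

End edge_weight_bounds.

(** * The grid of half-open cells *)

Section cells.
Context (R : realType) (d q : nat).
Hypothesis q_gt0 : (0 < q)%N.
Implicit Types c : {ffun 'I_d -> 'I_q}.

Definition cell c : set (d.-tuple R) :=
  [set x | forall i, (c i)%:R / q%:R <= tnth x i < (c i).+1%:R / q%:R].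

Lemma measurable_cell c : measurable (cell c).
Proof.
apply: (measurable_box
  (B := fun i => `[(c i)%:R / q%:R, (c i).+1%:R / q%:R[%classic)) => i.
exact: measurable_itv.
Qed.

Lemma cell_cover x : torus x -> exists c, cell c x.
Proof.
move=> Tx; have q0 : 0 < q%:R :> R by rewrite ltr0n.
have xq i : (Num.truncn (q%:R * tnth x i) < q)%N.
  have /andP[x0 x1] := Tx i; rewrite -(ltr_nat R).
  apply: (@le_lt_trans _ _ (q%:R * tnth x i)).
    by rewrite truncn_le// mulr_ge0.
  by rewrite -[ltRHS]mulr1 ltr_pM2l.
exists [ffun i => Ordinal (xq i)] => i; rewrite ffunE /=.
have /andP[x0 x1] := Tx i.
have xq0 : 0 <= q%:R * tnth x i by rewrite mulr_ge0// ltW.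
rewrite ler_pdivrMr// ltr_pdivlMr// (mulrC (tnth x i)) truncn_le xq0/=.
exact: truncnS_gt.
Qed.

Lemma cell_inj c c' x : cell c x -> cell c' x -> c = c'.
Proof.
move=> cx c'x; apply/ffunP => i; apply: val_inj => /=.
have q0 : 0 < q%:R :> R by rewrite ltr0n.
have := cx i; have := c'x i; rewrite !ler_pdivrMr// !ltr_pdivlMr//.
move=> /andP[h1 h2] /andP[h3 h4]; apply/eqP; rewrite eqn_leq.
apply/andP; split; rewrite -ltnS -(ltr_nat R).
  exact: le_lt_trans h3 h2.
exact: le_lt_trans h1 h4.
Qed.

Lemma cell_diam c x t : cell c x -> cell c t -> torus_dist x t <= q%:R^-1.
Proof.
move=> cx ct; apply/torus_dist_le; first by rewrite invr_ge0.
move=> i; rewrite /circle_dist ge_min ler_norml; apply/orP; left.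
have /andP[h1 h2] := cx i; have /andP[h3 h4] := ct i.
move: h1 h2 h3 h4; rewrite -[(c i).+1]addn1 natrD mulrDl mul1r.
by set a := _ / _; set b := q%:R^-1; lra.
Qed.

End cells.

(* Each occupied class contributes exactly 1. With the classes given by the cells
   of a grid, this replaces a lower tail bound on the number of points per cell. *)
Lemma sum_inv_class_size (R : realFieldType) (I J : finType) (c : I -> J) :
  \sum_u (#|[set x | c x == c u]%SET|%:R^-1 : R) <= #|J|%:R.
Proof.
rewrite (partition_big c predT)//= -sum1_card natr_sum.
apply: ler_sum => a _.
rewrite (eq_bigr (fun=> #|[set x | c x == a]%SET|%:R^-1)); last first.
  by move=> u /eqP ->.
rewrite sumr_const -[leLHS]mulr_natl.
rewrite (_ : #|[pred x | c x == a]| = #|[set x | c x == a]%SET|); last first.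
  by apply: eq_card => x; rewrite !inE.
have [->|N0] := eqVneq #|[set x | c x == a]%SET| 0%N; first by rewrite mul0r ler01.
by rewrite mulfV// pnatr_eq0.
Qed.

(** * Calls between far vertices *)

Section far_calls.
Context (R : realType) (d n : nat) (alpha theta1 theta2 : R).
Context (D : probability R R) (disp : measure_display).
Context (Omega : measurableType disp) (P : probability Omega R).
Variables (G : girg d n alpha theta1 theta2 D P) (Q : push_pull G).
Local Notation pr := (pr P).
Hypotheses (n_gt0 : (0 < n)%N) (theta1_gt0 : 0 < theta1) (theta12 : theta1 <= theta2)
  (theta2_le1 : theta2 <= 1).
Variables (b beta r0 : R) (L : nat) (q : nat -> nat).
Hypotheses (b_ge1 : 1 <= b) (beta_le : 0 < beta <= alpha) (r0_gt0 : 0 < r0).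
Hypotheses (q_gt0 : forall i, (0 < q i)%N)
  (q_large : forall i, n%:R * (6 * (q i)%:R^-1) ^+ d <= b ^+ i).

Definition weight_class i : set R := `[b ^+ i, b ^+ i.+1[%classic.
(* The factor 3 comes from (size of the cell of u) <= 3 max(1, number of vertices
   of that cell other than u and v); beta <= alpha replaces alpha because
   min(y^alpha, 1) <= y^beta. *)
Definition far_prob i j : R :=
  3 * theta2 / theta1 * ((b ^+ i.+1 * b ^+ j.+1) / (n%:R * r0 ^+ d)) `^ beta.
Local Notation dW i := (fine (D (weight_class i))).
Local Notation far x t := (~ (torus_dist x t <= r0)).

Lemma pr_two_weights k (A : set (k.-tuple (d.-tuple R))) (u v : 'I_k) (B1 B2 : set R) :
  measurable A -> measurable B1 -> measurable B2 -> u != v ->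
  pr [set w | [/\ num_vertices G w = k, A (positions G k w),
                  B1 (weight G u w) & B2 (weight G v w)]] =
  pr [set w | num_vertices G w = k /\ A (positions G k w)] * (fine (D B1) * fine (D B2)).
Proof.
move=> mA mB1 mB2 uv.
pose B (l : 'I_k) := if l == u then B1 else if l == v then B2 else setT.
have mB l : measurable (B l) by rewrite /B; case: ifP => // _; case: ifP.
rewrite (_ : [set w | [/\ _, _, _ & _]] = [set w | [/\ num_vertices G w = k,
    A (positions G k w) & forall i : 'I_k, B i (weight G i w)]]); last first.
  apply/seteqP; split=> w.
    move=> [Nk Aw W1 W2]; split => // i; rewrite /B.
    by case: eqVneq => [->//|_]; case: eqVneq => [->//|].
  move=> [Nk Aw BW]; split => //; first by have := BW u; rewrite /B eqxx.
  by have := BW v; rewrite /B eqxx eq_sym (negbTE uv).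
rewrite {1}/pr weight_law// (bigD1 u)//= (bigD1 v) 1?eq_sym//= big1; last first.
  by move=> i /andP[/negbTE iu /negbTE iv]; rewrite /B iu iv probability_setT.
rewrite /B !eqxx eq_sym (negbTE uv) mule1 fineM ?fineM//.
- by rewrite fin_num_measure.
- by rewrite fin_num_measure.
- rewrite fin_num_measure//.
  exact: measurableI (measurable_num_vertices _ _) (measurable_positions_preim _ mA).
- by rewrite fin_numM// fin_num_measure.
Qed.

Lemma pr_one_weight k (u : 'I_k) (B1 : set R) : measurable B1 ->
  pr [set w | num_vertices G w = k /\ B1 (weight G u w)] =
  pr [set w | num_vertices G w = k] * fine (D B1).
Proof.
move=> mB1.
pose B (l : 'I_k) := if l == u then B1 else setT.
have mB l : measurable (B l) by rewrite /B; case: ifP.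
rewrite (_ : [set w | _ /\ _] = [set w | [/\ num_vertices G w = k,
    setT (positions G k w) & forall i : 'I_k, B i (weight G i w)]]); last first.
  apply/seteqP; split=> w.
    by move=> [Nk Aw]; split => // i; rewrite /B; case: eqVneq => [->|].
  by move=> [Nk _ BW]; split => //; have := BW u; rewrite /B eqxx.
rewrite {1}/pr weight_law// (bigD1 u)//= big1; last first.
  by move=> i /negbTE iu; rewrite /B iu probability_setT.
rewrite (_ : [set w | _ /\ _] = [set w | num_vertices G w = k]); last first.
  by apply/seteqP; split=> w // [].
rewrite /B eqxx mule1 fineM// fin_num_measure//; exact: measurable_num_vertices.
Qed.

Definition cell_event k q' (c : {ffun 'I_k -> {ffun 'I_d -> 'I_q'}}) :
    set (k.-tuple (d.-tuple R)) :=
  [set z | forall u, cell (c u) (tnth z u)].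

(** The cells of all vertices are prescribed by [c], so that the set of vertices sharing the cell of
    [u] is deterministic, as [pr_edge_call] demands of its set [U]. *)
Definition far_marks k i j q' (c : {ffun 'I_k -> {ffun 'I_d -> 'I_q'}}) (u v : 'I_k) :
    set (k.-tuple (d.-tuple R * R)) :=
  [set z | [/\ valid_marks z, forall l, cell (c l) (tnth z l).1,
     weight_class i (tnth z u).2, weight_class j (tnth z v).2 &
     far (tnth z u).1 (tnth z v).1]].

Lemma measurable_cell_event k q' (c : {ffun 'I_k -> {ffun 'I_d -> 'I_q'}}) :
  measurable (cell_event c).
Proof.
apply: (measurable_forallT (B := fun u => [set z : k.-tuple (d.-tuple R) |
  cell (c u) (tnth z u)])) => u.
have := @measurable_tnth _ (d.-tuple R) k u measurableT _ (measurable_cell (c u)).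
by rewrite setTI.
Qed.

Let mpos k (l : 'I_k) :
  measurable_fun setT (fun z : k.-tuple (d.-tuple R * R) => (tnth z l).1).
Proof. by apply: (measurableT_comp measurable_fst); exact: measurable_tnth. Qed.

Let mweight k (l : 'I_k) :
  measurable_fun setT (fun z : k.-tuple (d.-tuple R * R) => (tnth z l).2).
Proof. by apply: (measurableT_comp measurable_snd); exact: measurable_tnth. Qed.

Let mcoord k (l : 'I_k) (i : 'I_d) :
  measurable_fun setT (fun z : k.-tuple (d.-tuple R * R) => tnth (tnth z l).1 i).
Proof.
apply: (measurableT_comp (f := fun x : d.-tuple R => tnth x i)) (mpos l).
exact: measurable_tnth.
Qed.

Lemma measurable_far_marks k i j q' (c : {ffun 'I_k -> {ffun 'I_d -> 'I_q'}}) (u v : 'I_k) :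
  measurable (far_marks i j c u v).
Proof.
rewrite (_ : far_marks _ _ _ _ _ =
  [set z | valid_marks z] `&` [set z | forall l, cell (c l) (tnth z l).1] `&`
  [set z | weight_class i (tnth z u).2] `&` [set z | weight_class j (tnth z v).2] `&`
  ~` [set z | torus_dist (tnth z u).1 (tnth z v).1 <= r0]); last first.
  by apply/seteqP; split=> z; [case|move=> [[[[]]]]].
repeat apply: measurableI.
- apply: (measurable_forallT (B := fun l => [set z : k.-tuple (d.-tuple R * R) |
    @torus R d (tnth z l).1 /\ 1 <= (tnth z l).2])) => l.
  apply: measurableI.
    apply: (measurable_preim (B := @torus R d) (mpos l)).
    exact: measurable_torus.
  rewrite [X in measurable X](_ : _ = [set z | (`[1%R, +oo[%classic : set R) (tnth z l).2]).
    by apply: (measurable_preim (B := (`[1%R, +oo[%classic : set R)) (mweight l)).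
  by apply/seteqP; split=> z; rewrite /= in_itv/= andbT.
- apply: (measurable_forallT (B := fun l => [set z : k.-tuple (d.-tuple R * R) |
    cell (c l) (tnth z l).1])) => l.
  apply: (measurable_preim (B := cell (c l)) (mpos l)).
  exact: measurable_cell.
- apply: (measurable_preim (B := weight_class i) (mweight u)).
  exact: measurable_itv.
- apply: (measurable_preim (B := weight_class j) (mweight v)).
  exact: measurable_itv.
- apply: measurableC.
  rewrite (_ : mkset _ = [set z : k.-tuple (d.-tuple R * R) | forall l,
    circle_dist (tnth (tnth z u).1 l) (tnth (tnth z v).1 l) <= r0]).
    apply: (measurable_forallT (B := fun l => [set z : k.-tuple (d.-tuple R * R) |
       circle_dist (tnth (tnth z u).1 l) (tnth (tnth z v).1 l) <= r0])) => l.
    rewrite -[mkset _]setTI; apply: (@measurable_fun_le _ _ _ setT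
      (fun z : k.-tuple (d.-tuple R * R) => circle_dist (tnth (tnth z u).1 l) (tnth (tnth z v).1 l)) (cst r0)) => //.
    exact: (measurable_circle_dist (mcoord u l) (mcoord v l)).
  by apply/seteqP; split=> z /=; apply torus_dist_le; rewrite ltW.
Qed.

(** [pr_edge_call] is applied with [U] the vertices of the cell of [u] other than [u] and [v]; they
    lie within 1 / q i of [u], whose weight is at least b^i, so [q_large] gives them edge weight 1.
    The inverse cell size stays explicit because it is summed over [u] later. *)
Lemma pr_far_marks k i j (c : {ffun 'I_k -> {ffun 'I_d -> 'I_(q i)}}) (u v : 'I_k) r :
  u != v ->
  pr (mark_event G (far_marks i j c u v) `&` [set w | edge G u v w = true] `&`
      [set w | call Q r u w = v]) <=
  far_prob i j * (dW i * dW j) * (#|[set x | c x == c u]%SET|%:R^-1 *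
  pr [set w | num_vertices G w = k /\ cell_event c (positions G k w)]).
Proof.
move=> uv.
pose U := [set x | (c x == c u) && ((x != u) && (x != v))]%SET.
pose m := #|[set x | c x == c u]%SET|.
set pbar := ((b ^+ i.+1 * b ^+ j.+1) / (n%:R * r0 ^+ d)) `^ beta.
have m3 : (m <= 3 * maxn 1 #|U|)%N.
  have : (m <= 2 + #|U|)%N.
    apply: (@leq_trans #|(u |: (v |: U))%SET|).
      apply: subset_leq_card; apply/fintype.subsetP => x; rewrite !inE => ->.
      by case: (x == u); case: (x == v).
    by rewrite !cardsU1; case: (_ \notin _); case: (_ \notin _); rewrite ?addn0//=; lia.
  by lia.
have m0 : (0 < m)%N by apply/card_gt0P; exists u; rewrite inE.
have bgt0 l : 0 < b ^+ l by rewrite exprn_gt0// (lt_le_trans ltr01).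
have uU : u \notin U by rewrite inE !eqxx !andbF.
have vU : v \notin U by rewrite inE (eqxx v) !andbF.
have vM z : far_marks i j c u v z -> valid_marks z by case.
have mM := measurable_far_marks i j c u v.
have a0 : 0 <= alpha by case/andP: beta_le => /ltW; exact: le_trans.
have mE0 := measurable_mark_event G mM.
have H := @pr_edge_call R d n alpha theta1 theta2 D disp Omega P G Q theta1_gt0 theta12
  theta2_le1 k (far_marks i j c u v) u v U r pbar mM vM uv uU vU.
set X := pr (_ `&` _ `&` _) in H *.
have {}H : theta1 * (maxn 1 #|U|)%:R * X <= theta2 * pbar * pr (mark_event G (far_marks i j c u v)).
  apply: H.
    move=> z [vz _ Wu Wv /negP ufar]; rewrite -ltNge in ufar.
    apply: edge_weight_far => //; [exact: (vz u).1|exact: (vz v).1|by rewrite r0_gt0 ltW|].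
    move: Wu Wv; rewrite /weight_class /= !in_itv/= => /andP[l1 r1] /andP[l2 r2].
    have p1 := le_trans (ltW (bgt0 i)) l1; have p2 := le_trans (ltW (bgt0 j)) l2.
    by rewrite mulr_ge0//= ler_pM// ltW.
  move=> z x [vz cz Wu _ _]; rewrite inE => /andP[/eqP cx _].
  move: Wu; rewrite /weight_class /= !in_itv/= => /andP[l1 r1].
  apply: (edge_weight_near n_gt0 a0 (r := (q i)%:R^-1) (w := b ^+ i)) => //.
    by apply: (cell_diam (c := c u)) => //; rewrite -cx.
  exact: (vz x).2.
have mk : measurable [set w | num_vertices G w = k /\ cell_event c (positions G k w)].
  exact: measurableI (measurable_num_vertices _ _)
    (measurable_positions_preim _ (measurable_cell_event c)).
(* Dropping validity and distance leaves conditions on positions and on two weights, and these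
   factorise by [weight_law]. *)
have pm : pr (mark_event G (far_marks i j c u v)) <=
    pr [set w | num_vertices G w = k /\ cell_event c (positions G k w)] * (dW i * dW j).
  rewrite -(pr_two_weights (measurable_cell_event c) _ _ uv); try exact: measurable_itv.
  apply: pr_mono => //.
    rewrite (_ : mkset _ = [set w | num_vertices G w = k /\ cell_event c (positions G k w)]
      `&` [set w | weight_class i (weight G u w)] `&` [set w | weight_class j (weight G v w)]).
      apply: measurableI; first apply: measurableI => //.
        apply: (measurable_preim (f := weight G u) (B := weight_class i)) => //.
        exact: measurable_itv.
      apply: (measurable_preim (f := weight G v) (B := weight_class j)) => //.
      exact: measurable_itv.
    by apply/seteqP; split=> w; [case|move=> [[[]]]].
  move=> w [Nk [_ cz Wu Wv _]]; rewrite !tnth_mktuple /= in Wu Wv; split => //.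
  by move=> l; have := cz l; rewrite !tnth_mktuple.
have t20 : 0 < theta2 by exact: lt_le_trans theta12.
have pb0 : 0 <= pbar by exact: powR_ge0.
have X0 : 0 <= X by exact: pr_ge0.
rewrite mulrCA -/m -[leRHS]mulrC ler_pdivlMr ?ltr0n//.
rewrite /far_prob -/pbar mulrA in pm *.
rewrite -(ler_pM2l theta1_gt0).
apply: (@le_trans _ _ (3 * (theta1 * (maxn 1 #|U|)%:R * X))).
  rewrite (_ : 3 * _ = theta1 * (X * (3 * maxn 1 #|U|)%:R)).
    by rewrite ler_pM2l// ler_wpM2l// ler_nat.
  by rewrite natrM; ring.
apply: (@le_trans _ _ (3 * (theta2 * pbar * pr (mark_event G (far_marks i j c u v))))).
  by rewrite ler_pM2l.
apply: (@le_trans _ _ (3 * theta2 * pbar *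
  (pr [set w | num_vertices G w = k /\ cell_event c (positions G k w)] * dW i * dW j))).
  by rewrite 2!mulrA ler_wpM2l// mulr_ge0// mulr_ge0// ltW.
rewrite le_eqVlt; apply/orP; left; apply/eqP; field.
by rewrite gt_eqF.
Qed.

End far_calls.

Lemma geometric_class (R : realType) (b y : R) (L : nat) :
  1 <= y < b ^+ L -> exists2 i, (i < L)%N & b ^+ i <= y < b ^+ i.+1.
Proof.
elim: L => [|L IH]; first by rewrite expr0 => /andP[/le_lt_trans h /h]; rewrite ltxx.
move=> /andP[y1 yb]; have [yL|yL] := ltP y (b ^+ L).
  by have [|i iL h] := IH; [rewrite y1 yL|exists i => //; exact: ltnW].
by exists L => //; rewrite yL yb.
Qed.

(** * Union bound over cells, weight classes and rounds *)

Section far_calls_union.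
Context (R : realType) (d n : nat) (alpha theta1 theta2 : R).
Context (D : probability R R) (disp : measure_display).
Context (Omega : measurableType disp) (P : probability Omega R).
Variables (G : girg d n alpha theta1 theta2 D P) (Q : push_pull G).
Local Notation pr := (pr P).
Hypotheses (n_gt0 : (0 < n)%N) (theta1_gt0 : 0 < theta1) (theta12 : theta1 <= theta2)
  (theta2_le1 : theta2 <= 1).
Variables (b beta r0 : R) (L : nat) (q : nat -> nat).
Hypotheses (b_ge1 : 1 <= b) (beta_le : 0 < beta <= alpha) (r0_gt0 : 0 < r0).
Hypotheses (q_gt0 : forall i, (0 < q i)%N)
  (q_large : forall i, n%:R * (6 * (q i)%:R^-1) ^+ d <= b ^+ i).
Hypothesis D_low : D `]-oo, 1[%classic = 0%E.

Local Notation dW i := (fine (D (weight_class b i))).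
Local Notation fp i j := (far_prob d n theta1 theta2 b beta r0 i j).
Local Notation index k i :=
  ({ffun 'I_k -> {ffun 'I_d -> 'I_(q i)}} * 'I_k * 'I_k)%type.

(** Here [i] is the class of the caller and [j] that of the called vertex. Only the caller's class
    determines the grid, since it is the caller's degree that is estimated. *)
Definition far_class_event k i j r : set Omega :=
  [set w | exists x : index k i, [set w | x.1.2 != x.2] w /\
    (mark_event G (far_marks b r0 i j x.1.1 x.1.2 x.2) `&`
     [set w | edge G x.1.2 x.2 w = true] `&` [set w | call Q r x.1.2 w = x.2]) w].

Lemma measurable_far_cell_event k i j r (x : index k i) :
  measurable (mark_event G (far_marks b r0 i j x.1.1 x.1.2 x.2) `&`
    [set w | edge G x.1.2 x.2 w = true] `&` [set w | call Q r x.1.2 w = x.2]).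
Proof.
apply: measurableI (measurable_call _ _ _ _); apply: measurableI (measurable_edge _ _ _ _).
by apply: measurable_mark_event; exact: measurable_far_marks.
Qed.

Lemma measurable_far_class_event k i j r : measurable (far_class_event k i j r).
Proof.
apply: (measurable_existsT (B := fun x : index k i => [set w | x.1.2 != x.2] `&`
  (mark_event G (far_marks b r0 i j x.1.1 x.1.2 x.2) `&`
     [set w | edge G x.1.2 x.2 w = true] `&` [set w | call Q r x.1.2 w = x.2]))) => x.
apply: measurableI (measurable_far_cell_event _ _ _).
by case: (x.1.2 != x.2); [rewrite (_ : mkset _ = setT)//; apply/seteqP; split|
  rewrite (_ : mkset _ = set0)//; apply/seteqP; split].
Qed.

(** The sum over [v] gives k, the sum over [u] of the inverse cell sizes gives at most the number (q
    i)^d of cells, and the events of different cell assignments are disjoint, so their probabilities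
    add up to at most that of k vertices. *)
Lemma pr_far_class k i j r :
  pr (far_class_event k i j r) <=
  fp i j * (dW i * dW j) * (k%:R * (q i)%:R ^+ d) * pr [set w | num_vertices G w = k].
Proof.
pose N k := [set w | num_vertices G w = k].
pose NC (c : {ffun 'I_k -> {ffun 'I_d -> 'I_(q i)}}) :=
  [set w | num_vertices G w = k /\ cell_event c (positions G k w)].
have mNC c : measurable (NC c).
  exact: measurableI (measurable_num_vertices _ _)
    (measurable_positions_preim _ (measurable_cell_event c)).
have theta2_gt0 : 0 < theta2 by exact: lt_le_trans theta12.
have fp0 : 0 <= fp i j by rewrite mulr_ge0 ?powR_ge0// divr_ge0 ?mulr_ge0// ltW.
have F0 : 0 <= fp i j * (dW i * dW j) by rewrite mulr_ge0// mulr_ge0// fine_ge0.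
apply: (@le_trans _ _ (\sum_(x : index k i | x.1.2 != x.2)
  fp i j * (dW i * dW j) * (#|[set y | x.1.1 y == x.1.1 x.1.2]%SET|%:R^-1 * pr (NC x.1.1)))).
  apply: (@le_trans _ _ (\sum_(x : index k i | x.1.2 != x.2)
     pr (mark_event G (far_marks b r0 i j x.1.1 x.1.2 x.2) `&`
     [set w | edge G x.1.2 x.2 w = true] `&` [set w | call Q r x.1.2 w = x.2]))).
    apply: pr_cover_le; first exact: measurable_far_class_event.
      by move=> x _; exact: measurable_far_cell_event.
    by move=> w [x [xuv xw]]; exists x; split => //; rewrite mem_index_enum.
  by apply: ler_sum => x xuv; apply: pr_far_marks.
apply: (@le_trans _ _ (\sum_(x : index k i)
  fp i j * (dW i * dW j) * (#|[set y | x.1.1 y == x.1.1 x.1.2]%SET|%:R^-1 * pr (NC x.1.1)))).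
  rewrite [leRHS](bigID (fun x : index k i => x.1.2 != x.2))/= lerDl.
  by apply: sumr_ge0 => x _; rewrite mulr_ge0// mulr_ge0 ?invr_ge0// pr_ge0.
rewrite -mulr_sumr -[leRHS]mulrA ler_wpM2l//.
pose g (c : {ffun 'I_k -> {ffun 'I_d -> 'I_(q i)}}) (u : 'I_k) : R :=
  #|[set y | c y == c u]%SET|%:R^-1 * pr (NC c).
rewrite -(pair_bigA _ (fun (x : _ * 'I_k) (v : 'I_k) => g x.1 x.2))/=.
rewrite -(pair_bigA _ (fun c u => \sum_(v < k) g c u))/=.
apply: (@le_trans _ _ (\sum_(c : {ffun 'I_k -> {ffun 'I_d -> 'I_(q i)}})
    k%:R * (q i)%:R ^+ d * pr (NC c))).
  apply: ler_sum => c _.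
  under eq_bigr do rewrite sumr_const card_ord -mulr_natl.
  rewrite -mulr_sumr -mulrA ler_wpM2l// /g -mulr_suml ler_wpM2r ?pr_ge0//.
  apply: (le_trans (sum_inv_class_size R c)).
  by rewrite card_ffun !card_ord natrX.
rewrite -mulr_sumr ler_wpM2l ?mulr_ge0 ?exprn_ge0//.
apply: pr_sum_le => //.
- exact: index_enum_uniq.
- exact: measurable_num_vertices.
- by move=> c _ w [].
- move=> c c' _ _ cc'; rewrite -subset0 => w [[_ cw] [_ c'w]].
  move/eqP: cc'; apply; apply/ffunP => u.
  by apply: (cell_inj (q_gt0 i)) (cw u) (c'w u).
Qed.

Definition far_call_event (T k : nat) : set Omega :=
  [set w | num_vertices G w = k /\ exists x : 'I_T * 'I_k * 'I_k,
    [/\ edge G x.1.2 x.2 w = true, call Q x.1.1 x.1.2 w = x.2 &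
        ~ (torus_dist (position G x.1.2 w) (position G x.2 w) <= r0)]].

Lemma measurable_far_call_event T k : measurable (far_call_event T k).
Proof.
apply: measurableI (measurable_num_vertices _ _) _.
apply: (measurable_existsT (B := fun x : 'I_T * 'I_k * 'I_k =>
   [set w | [/\ edge G x.1.2 x.2 w = true, call Q x.1.1 x.1.2 w = x.2 &
        ~ (torus_dist (position G x.1.2 w) (position G x.2 w) <= r0)]])) => x.
rewrite (_ : mkset _ = [set w | edge G x.1.2 x.2 w = true] `&`
   [set w | call Q x.1.1 x.1.2 w = x.2] `&`
   ~` [set w | torus_dist (position G x.1.2 w) (position G x.2 w) <= r0]); last first.
  by apply/seteqP; split=> w; [case|move=> [[]]].
apply: measurableI.
  exact: measurableI (measurable_edge _ _ _ _) (measurable_call _ _ _ _).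
apply: measurableC.
rewrite (_ : mkset _ = [set w | forall l, circle_dist (tnth (position G x.1.2 w) l)
    (tnth (position G x.2 w) l) <= r0]); last first.
  by apply/seteqP; split=> z /=; apply torus_dist_le; rewrite ltW.
have mco u (l : 'I_d) : measurable_fun setT (fun w => tnth (position G u w) l).
  apply: (measurableT_comp (f := fun x : d.-tuple R => tnth x l)) => //.
  exact: measurable_tnth.
apply: (measurable_forallT (B := fun l => [set w |
  circle_dist (tnth (position G x.1.2 w) l) (tnth (position G x.2 w) l) <= r0])) => l.
rewrite -[mkset _]setTI; apply: (@measurable_fun_le _ _ _ setT
  (fun w => circle_dist (tnth (position G x.1.2 w) l) (tnth (position G x.2 w) l)) (cst r0)) => //.
exact: measurable_circle_dist (mco _ _) (mco _ _).
Qed.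

(** A far call needs a vertex of weight below 1 (probability 0 by [D_low]), a vertex of weight at
    least b^L (the tail term, once for each of the k vertices), or a pair of classes below L. The
    first case arises because [edge_prob_bounds] assumes that all weights are at least 1. *)
Lemma pr_far_call T k :
  pr (far_call_event T k) <= pr [set w | num_vertices G w = k] * k%:R *
   (fine (D `[b ^+ L, +oo[%classic) +
    \sum_(i < L) \sum_(j < L) T%:R * (fp i j * (dW i * dW j) * (q i)%:R ^+ d)).
Proof.
pose N := [set w | num_vertices G w = k].
pose I := ('I_k + 'I_k + 'I_L * 'I_L * 'I_T)%type.
pose B (x : I) : set Omega := match x with
  | inl (inl u) => [set w | num_vertices G w = k /\ `]-oo, 1[%classic (weight G u w)]
  | inl (inr u) => [set w | num_vertices G w = k /\ `[b ^+ L, +oo[%classic (weight G u w)]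
  | inr (i, j, r) => far_class_event k i j r end.
have mW u (A : set R) : measurable A -> measurable [set w | A (weight G u w)].
  by move=> mA; apply: (measurable_preim (f := weight G u) (B := A)).
have mB x : measurable (B x).
  case: x => [[u|u]|[[i j] r]] /=.
  - exact: measurableI (measurable_num_vertices _ _) (mW u _ (measurable_itv `]-oo, 1[)).
  - exact: measurableI (measurable_num_vertices _ _) (mW u _ (measurable_itv `[b ^+ L, +oo[)).
  - exact: measurable_far_class_event.
apply: (@le_trans _ _ (\sum_x pr (B x))).
  apply: pr_cover_le => //; first exact: measurable_far_call_event.
  move=> w [Nk [[[r u] v] /= [uv cuv nfar]]].
  have [[l l1]|/forallNP lW1] := pselect (exists l : 'I_k, weight G l w < 1).
    by exists (inl (inl l)); split; rewrite ?mem_index_enum//= in_itv/=.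
  have [[l l1]|/forallNP lWL] := pselect (exists l : 'I_k, b ^+ L <= weight G l w).
    by exists (inl (inr l)); split; rewrite ?mem_index_enum//= in_itv/= l1.
  have W1 l : 1 <= weight G (l : 'I_k) w by rewrite leNgt; apply/negP; exact: lW1.
  have WL l : weight G (l : 'I_k) w < b ^+ L by rewrite ltNge; apply/negP; exact: lWL.
  have [i iL Wi] := geometric_class (introT andP (conj (W1 u) (WL u))).
  have [j jL Wj] := geometric_class (introT andP (conj (W1 v) (WL v))).
  exists (inr (Ordinal iL, Ordinal jL, r)); split; rewrite ?mem_index_enum//=.
  have Tw l : @torus R d (position G (l : 'I_k) w).
    by apply: position_torus; rewrite Nk.
  have cex l : exists c : {ffun 'I_d -> 'I_(q i)}, cell c (position G (l : 'I_k) w).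
    exact: cell_cover.
  have [c cP] := choice cex.
  exists (finfun c, u, v); split => /=.
    by apply: contra_eqN uv => /eqP ->; rewrite edge_irr.
  split => //; split => //; split => //; split; rewrite ?tnth_mktuple//=.
  - by move=> l; rewrite tnth_mktuple; split => /=; [exact: Tw|exact: W1].
  - by move=> l; rewrite tnth_mktuple ffunE /=; exact: cP.
rewrite big_sumType/= big_sumType/= mulrDr; apply: lerD.
  rewrite [X in X + _]big1 ?add0r; last first.
    move=> u _; have := pr_one_weight G u (measurable_itv `]-oo, 1%R[).
    by rewrite D_low/= mulr0.
  rewrite (eq_bigr (fun=> pr N * fine (D `[b ^+ L, +oo[%classic))); last first.
    by move=> u _; exact: (pr_one_weight G u (measurable_itv `[b ^+ L, +oo[)).
  by rewrite sumr_const card_ord -[leLHS]mulr_natl mulrA (mulrC k%:R).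
rewrite (eq_bigr (fun x : 'I_L * 'I_L * 'I_T => pr (far_class_event k x.1.1 x.1.2 x.2))); last first.
  by move=> [[i j] r] _.
rewrite -(pair_bigA _ (fun (x : 'I_L * 'I_L) (r : 'I_T) => pr (far_class_event k x.1 x.2 r)))/=.
rewrite -(pair_bigA _ (fun (i j : 'I_L) => \sum_(r < T) pr (far_class_event k i j r)))/=.
rewrite mulr_sumr; apply: ler_sum => i _; rewrite mulr_sumr; apply: ler_sum => j _.
apply: (@le_trans _ _ (\sum_(r < T) fp i j * (dW i * dW j) * (k%:R * (q i)%:R ^+ d) * pr N)).
  by apply: ler_sum => r _; exact: pr_far_class.
rewrite sumr_const card_ord -[leLHS]mulr_natl le_eqVlt; apply/orP; left; apply/eqP.
by rewrite /N; ring.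
Qed.

Definition far_call_before (T K : nat) : set Omega :=
  [set w | exists k : 'I_K, far_call_event T k w].

(** Replacing the factor k by K lets the probabilities of the vertex numbers sum to at most 1.
    Vertex numbers from K on are left to the Poisson tail. *)
Lemma pr_far_call_before T K :
  pr (far_call_before T K) <= K%:R *
   (fine (D `[b ^+ L, +oo[%classic) +
    \sum_(i < L) \sum_(j < L) T%:R * (fp i j * (dW i * dW j) * (q i)%:R ^+ d)).
Proof.
set S := _ + _.
have theta2_gt0 : 0 < theta2 by exact: lt_le_trans theta12.
have S0 : 0 <= S.
  rewrite addr_ge0 ?fine_ge0//; apply: sumr_ge0 => i _; apply: sumr_ge0 => j _.
  by rewrite !mulr_ge0 ?exprn_ge0 ?powR_ge0 ?fine_ge0 ?invr_ge0 ?(ltW theta1_gt0) ?(ltW theta2_gt0).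
apply: (@le_trans _ _ (\sum_(k < K) pr (far_call_event T k))).
  apply: pr_cover_le.
  - apply: (measurable_existsT (B := fun k : 'I_K => far_call_event T k)) => k.
    exact: measurable_far_call_event.
  - by move=> k _; exact: measurable_far_call_event.
  - by move=> w [k ?]; exists k; split; rewrite ?mem_index_enum.
apply: (@le_trans _ _ (\sum_(k < K) pr [set w | num_vertices G w = k] * (K%:R * S))).
  apply: ler_sum => k _; apply: (le_trans (pr_far_call T k)).
  rewrite -mulrA ler_wpM2l ?pr_ge0// ler_wpM2r// ler_nat.
  exact: ltnW.
rewrite -mulr_suml -[leRHS]mul1r ler_wpM2r ?mulr_ge0//.
have -> : 1 = pr setT by rewrite /pr probability_setT.
apply: pr_sum_le => //.
- exact: index_enum_uniq.
- by move=> k _; exact: measurable_num_vertices.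
- move=> k l _ _ kl; rewrite -subset0 => w [/= Nk Nl].
  by move/eqP: kl; apply; apply: val_inj; rewrite /= -Nk -Nl.
Qed.

End far_calls_union.

(** * Tails of power laws *)

Section power_law_tail.
Context (R : realType) (tau : R) (D : probability R R).
Hypotheses (tau_gt2 : 2 < tau).
Local Notation tail x := (fine (D `[x, +oo[%classic)).

Let tau0 : 0 <= tau.
Proof. exact: le_trans (ltW tau_gt2). Qed.

Let measurable_posint : measurable [set (k.+1%:R : R) | k in [set: nat]].
Proof.
rewrite [X in measurable X](_ : _ = \bigcup_k [set (k.+1%:R : R)]).
  by apply: bigcupT_measurable => k; exact: measurable_set1.
by apply/seteqP; split=> x [k _ ?]; exists k.
Qed.

Lemma power_law_low : power_law tau D -> D `]-oo, 1[%classic = 0%E.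
Proof.
move=> [[f [mf f0 f1 Df _]]|[D1 _]].
  rewrite Df; last exact: measurable_itv.
  by apply: integral0_eq => x; rewrite /= in_itv/= => /f1 ->.
have mS := measurable_posint.
have mI : measurable (`]-oo, 1[%classic : set R) by exact: measurable_itv.
rewrite prE//; congr (_%:E); apply/eqP; rewrite eq_le pr_ge0 andbT.
apply: (@le_trans _ _ (pr D (~` [set (k.+1%:R : R) | k in [set: nat]]))).
  apply: pr_mono => //; first exact: measurableC.
  move=> x /=; rewrite in_itv/= => x1 [k _ kx].
  by move: x1; rewrite -kx ltNge ler1n.
by rewrite pr_setC// /pr D1 subrr.
Qed.

Lemma density_dyadic : density_power_law tau D -> exists c x0 : R, [/\ 0 < c, 1 <= x0 &
  forall x, x0 <= x -> fine (D `[x, 2 * x[%classic) <= c * x `^ (1 - tau)].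
Proof.
move=> [f [mf f0 f1 Df [c1 [c2 [c10 c20 [M [_ fM]]]]]]].
(* The density bound holds for arguments above M, strictly; hence M + 1. *)
exists c2, (Num.max 1 (M + 1)); split => //; first by rewrite le_max lexx.
move=> x; rewrite ge_max => /andP[x1 xM].
have mI : measurable (`[x, 2 * x[%classic : set R) by exact: measurable_itv.
have x0 : 0 < x by lra.
rewrite -lee_fin fineK ?fin_num_measure// Df//.
apply: (@le_trans _ _ (\int[lebesgue_measure]_(y in `[x, (2 * x)%R[) (c2 * x `^ (- tau))%:E)%E).
  apply: ge0_le_integral => //.
  - by move=> y _; rewrite lee_fin.
  - by apply/measurable_EFinP; exact: measurable_funTS.
  - move=> y; rewrite /= in_itv/= => /andP[xy y2]; rewrite lee_fin.
    have /andP[_] := fM y (ltac:(lra)); move/le_trans; apply.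
    have y0 : 0 < y by exact: lt_le_trans xy.
    rewrite ler_wpM2l ?(ltW c20)// !powRN lef_pV2 ?posrE ?powR_gt0//.
    by apply: ge0_ler_powR => //; rewrite ?nnegrE ltW.
have := integral_cst (@lebesgue_measure R) mI (c2 * x `^ (- tau))%:E; rewrite /cst => ->.
have lx : lebesgue_measure (`[x, 2 * x[%classic : set R) = x%:E.
  rewrite lebesgue_measure_itv/= lte_fin ifT; last by lra.
  by rewrite -EFinD; congr (_%:E); lra.
rewrite [X in (_ * X)%E](_ : _ = x%:E)//.
rewrite -EFinM lee_fin -mulrA ler_wpM2l ?(ltW c20)//.
rewrite powRB; last by rewrite (gt_eqF x0) implybT.
by rewrite powRr1 ?(ltW x0)// powRN mulrC.
Qed.

Lemma discrete_dyadic : discrete_power_law tau D -> exists c x0 : R, [/\ 0 < c, 1 <= x0 &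
  forall x, x0 <= x -> fine (D `[x, 2 * x[%classic) <= c * x `^ (1 - tau)].
Proof.
move=> [D1 [c1 [c2 [c10 c20 [M _ fM]]]]].
exists (3 * c2), M.+1%:R; split; [by rewrite mulr_gt0|by rewrite ler1n|].
move=> x xM; have x1 : 1 <= x by apply: le_trans xM; rewrite ler1n.
have x0 : 0 < x by lra.
pose S := [set (k.+1%:R : R) | k in [set: nat]].
have mS : measurable S by exact: measurable_posint.
have mI : measurable (`[x, 2 * x[%classic : set R) by exact: measurable_itv.
have DS : pr D (~` S) = 0 by rewrite pr_setC// /pr D1 subrr.
(* The integers in [x, 2x) lie below K, and K <= 2x + 1 <= 3x as x >= 1. This explains the constant
   3 c2. *)
pose K := (Num.truncn (2 * x)).+1.
have KS : K%:R <= 3 * x.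
  rewrite /K -natr1; have : (Num.truncn (2 * x))%:R <= 2 * x by rewrite truncn_le; lra.
  lra.
apply: (@le_trans _ _ (pr D (`[x, 2 * x[%classic `&` S))).
  rewrite -[leRHS]addr0 -DS -[leLHS]/(pr D _).
  apply: le_trans (pr_setU _ _ _); [|exact: measurableI|exact: measurableC].
  apply: pr_mono => //; first by apply: measurableU; [exact: measurableI|exact: measurableC].
  by move=> y xy; have [Sy|nS] := pselect (S y); [left|right].
apply: (@le_trans _ _ (\sum_(k < K | x <= (k : nat)%:R) pr D [set (k : nat)%:R])).
  apply: pr_cover_le; first exact: measurableI.
    by move=> k _; exact: measurable_set1.
  move=> y [] /=; rewrite in_itv/= => /andP[xy y2] [k _ ky].
  have kK : (k.+1 < K)%N.
    by rewrite ltnS truncn_ge_nat ?ky ?ltW//; lra.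
  by exists (Ordinal kK); split => //=; rewrite ?mem_index_enum// ky.
apply: (@le_trans _ _ (\sum_(k < K | x <= (k : nat)%:R) c2 * x `^ (- tau))).
  apply: ler_sum => k xk; have Mk : (M <= k)%N.
    by rewrite -(ler_nat R) (le_trans _ xk)// (le_trans _ xM)// ler_nat.
  have /andP[_] := fM k Mk; move/le_trans; apply.
  have k0 : 0 < k%:R :> R by lra.
  rewrite ler_wpM2l ?(ltW c20)// !powRN lef_pV2 ?posrE ?powR_gt0//.
  by apply: ge0_ler_powR => //; rewrite ?nnegrE ?ltW.
apply: (@le_trans _ _ (\sum_(k < K) c2 * x `^ (- tau))).
  rewrite [leRHS](bigID (fun k : 'I_K => x <= (k : nat)%:R))/= lerDl.
  by apply: sumr_ge0 => k _; rewrite mulr_ge0 ?powR_ge0// ltW.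
rewrite sumr_const card_ord -[leLHS]mulr_natl.
rewrite powRB; last by rewrite (gt_eqF x0) implybT.
rewrite powRr1 ?(ltW x0)// powRN.
rewrite (_ : 3 * c2 * _ = 3 * x * (c2 / x `^ tau)); last by ring.
by rewrite ler_wpM2r// divr_ge0 ?powR_ge0// ltW.
Qed.

Lemma tail_cvg0 (e : R) : 0 < e -> exists N : nat, tail N%:R < e.
Proof.
move=> e0.
pose F (k : nat) : set R := `[k%:R, +oo[%classic.
have mF k : measurable (F k) by exact: measurable_itv.
have F0 : \bigcap_k F k = set0.
  rewrite -subset0 => x Fx; have := Fx (Num.truncn `|x|).+1 I.
  rewrite /F /= in_itv/= andbT; apply/negP; rewrite -ltNge.
  exact: le_lt_trans (ler_norm x) (truncnS_gt _).
have cF : (D (F k) @[k --> \oo] --> 0)%E.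
  rewrite -(measure0 D) -F0; apply: nonincreasing_cvg_mu => //.
  - by rewrite ltey_eq fin_num_measure.
  - by rewrite F0.
  - apply/nonincreasing_seqP => k; apply/subsetPset => x.
    by rewrite /F /= !in_itv/= !andbT; apply: le_trans; rewrite ler_nat.
have [N _ /(_ N (leqnn N)) /= DN] : \forall k \near \oo, fine (D (F k)) < e.
  by apply: (cvgr_lt _ (fine_cvg cF)).
by exists N.
Qed.

(** The tail is a sum of dyadic blocks. As tau > 2, doubling x at least halves x^(1 - tau), so the
    blocks sum to at most twice the first, and the remainder vanishes by [tail_cvg0]. Below the
    threshold x0 a probability is at most 1 <= x0^(tau - 1) x^(1 - tau). *)
Lemma power_law_tail : power_law tau D -> exists2 C : R, 0 < C &
  forall x, 1 <= x -> tail x <= C * x `^ (1 - tau).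
Proof.
move=> pD.
have [c [x0 [c0 x01 dy]]] : exists c x0 : R, [/\ 0 < c, 1 <= x0 &
  forall x, x0 <= x -> fine (D `[x, 2 * x[%classic) <= c * x `^ (1 - tau)].
  by case: pD; [exact: density_dyadic|exact: discrete_dyadic].
have mI (x : R) : measurable (`[x, +oo[%classic : set R) by exact: measurable_itv.
have mJ (x : R) : measurable (`[x, 2 * x[%classic : set R) by exact: measurable_itv.
have step x : x0 <= x -> tail x <= c * x `^ (1 - tau) + tail (2 * x).
  move=> xx; apply: (@le_trans _ _ (fine (D `[x, 2 * x[%classic) + tail (2 * x))).
    apply: le_trans (pr_setU _ (mJ x) (mI _)).
    apply: pr_mono => //; first exact: measurableU.
    move=> y /=; rewrite !in_itv/= !andbT => xy.
    by have [y2|y2] := ltP y (2 * x); [left|right]; rewrite ?xy.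
  by rewrite lerD2r dy.
have iter J : forall x, x0 <= x ->
    tail x <= 2 * c * x `^ (1 - tau) + tail (2 ^+ J * x).
  elim: J => [|J IH] x xx.
    by rewrite expr0 mul1r lerDr !mulr_ge0 ?powR_ge0// ltW.
  have x0p : 0 < x by lra.
  have xx2 : x0 <= 2 * x by lra.
  apply: (le_trans (step x xx)); have := IH _ xx2.
  rewrite (_ : 2 ^+ J.+1 * x = 2 ^+ J * (2 * x)); last by rewrite exprSr mulrA.
  (* The induction closes because 2c = c + c: one c pays for the current block, the other for all
     later ones. *)
  suff : 2 * c * (2 * x) `^ (1 - tau) <= c * x `^ (1 - tau).
    set p1 := c * _; set p2 := 2 * c * _; set p3 := 2 * c * _.
    have -> : p3 = p1 + p1 by rewrite /p3 /p1; ring.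
    by move: p1 p2 => p1 p2; lra.
  rewrite -mulrA mulrCA ler_wpM2l ?(ltW c0)//.
  rewrite powRM ?ler0n ?(ltW x0p)// mulrA -[leRHS]mul1r ler_wpM2r ?powR_ge0//.
  rewrite powRB ?powRr1// ?mulrA; last by rewrite pnatr_eq0 implybT.
  rewrite ler_pdivrMr ?powR_gt0// mul1r -expr2 -powR_mulrn//.
  by rewrite ler_powR ?ler1n ?ltW.
have big x : x0 <= x -> tail x <= 2 * c * x `^ (1 - tau).
  move=> xx; apply/ler_addgt0Pr => e e0; have [N Ne] := tail_cvg0 e0.
  apply: (le_trans (iter N x xx)); rewrite lerD2l; apply: le_trans (ltW Ne).
  apply: pr_mono => // y /=; rewrite !in_itv/= !andbT; apply: le_trans.
  apply: (@le_trans _ _ (2 ^+ N)).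
    by rewrite -natrX ler_nat; exact/ltnW/ltn_expl.
  by rewrite ler_peMr ?exprn_ge0// (le_trans x01).
exists (2 * c + x0 `^ (tau - 1)); first by rewrite ltr_wpDr ?powR_ge0 ?mulr_gt0.
move=> x x1; have x0p : 0 < x by lra.
have [xx|xx] := leP x0 x.
  by apply: (le_trans (big _ xx)); rewrite ler_wpM2r ?powR_ge0// lerDl powR_ge0.
apply: (@le_trans _ _ 1); first exact: pr_le1.
rewrite mulrDl; apply: ler_wpDl; first by rewrite !mulr_ge0 ?powR_ge0// ltW.
rewrite (_ : 1 - tau = - (tau - 1)); last by ring.
rewrite powRN ler_pdivlMr ?powR_gt0// mul1r.
have tg := tau_gt2.
by apply: ge0_ler_powR; rewrite ?nnegrE; lra.
Qed.

End power_law_tail.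

(** * Poisson counts *)

Section poisson_tail.
Variable R : realType.
Implicit Types (lambda : R) (a M : nat).

Lemma exp_partial_sum_le lambda M : 0 <= lambda ->
  \sum_(0 <= m < M) lambda ^+ m / m`!%:R <= expR lambda.
Proof.
move=> l0; have := nondecreasing_cvgn_le _ (is_cvg_series_exp_coeff lambda) M.
rewrite /series /= /exp_coeff /=; apply.
apply/nondecreasing_seqP => m; rewrite /series /= big_nat_recr//= lerDl.
by rewrite divr_ge0 ?exprn_ge0.
Qed.

(* For m >= a one has m (m - 1) >= a (a - 1), and dividing by m! shifts the
   exponential series by two. *)
Lemma exp_tail_le lambda a : 0 <= lambda -> (2 <= a)%N ->
  expR lambda <= \sum_(0 <= m < a) lambda ^+ m / m`!%:R +
    lambda ^+ 2 / (a%:R * a.-1%:R) * expR lambda.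
Proof.
move=> l0 a2; have cv := is_cvg_series_exp_coeff lambda.
rewrite [leLHS](_ : _ = limn (series (exp_coeff lambda)))//.
apply: limr_le => //; near=> M.
have aM : (a <= M)%N by near: M; exact: nbhs_infty_ge.
rewrite /series /= (@big_cat_nat _ _ _ a)//= lerD2l.
have pos m : 0 <= lambda ^+ m / m`!%:R by rewrite divr_ge0 ?exprn_ge0.
have a0 : (0 < a)%N by exact: ltnW.
have a10 : (0 < a.-1)%N by rewrite ltn_predRL.
have aa : 0 < a%:R * a.-1%:R :> R by rewrite mulr_gt0// ltr0n.
apply: (@le_trans _ _ (\sum_(a <= m < M) lambda ^+ 2 / (a%:R * a.-1%:R) *
    (lambda ^+ (m - 2) / (m - 2)`!%:R))).
  rewrite big_nat_cond [leRHS]big_nat_cond; apply: ler_sum => m.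
  rewrite andbT => /andP[am _]; rewrite /exp_coeff /=.
  have m2 : (2 <= m)%N by exact: leq_trans am.
  rewrite -{1 2}(subnK m2) exprD addn2 !factS !natrM.
  set p := (m - 2)%N; have pa : (a <= p.+2)%N by rewrite /p -addn2 subnK.
  have f0 : 0 < p`!%:R :> R by rewrite ltr0n fact_gt0.
  rewrite [leRHS](_ : _ = lambda ^+ p * lambda ^+ 2 *
     ((a%:R * a.-1%:R)^-1 * p`!%:R^-1)); last by rewrite mulrACA (mulrC (lambda ^+ 2)).
  rewrite ler_wpM2l ?mulr_ge0 ?exprn_ge0//.
  rewrite -invfM lef_pV2 ?posrE ?mulr_gt0 ?ltr0n ?fact_gt0//.
  rewrite mulrA ler_wpM2r// ler_pM// ler_nat//.
  by rewrite -subn1 leq_subLR add1n.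
rewrite -mulr_sumr ler_wpM2l ?divr_ge0 ?exprn_ge0 ?(ltW aa)//.
rewrite -{1}(subnK a2) big_addn.
under eq_bigr do rewrite addnK.
apply: le_trans (exp_partial_sum_le (M - 2) l0).
rewrite [leRHS](@big_cat_nat _ _ _ (a - 2)) ?leq_sub2r//= lerDr.
by apply: sumr_ge0.
Unshelve. all: by end_near.
Qed.
End poisson_tail.

Section counting.
Context (R : realType) (d n : nat) (alpha theta1 theta2 : R).
Context (D : probability R R) (disp : measure_display).
Context (Omega : measurableType disp) (P : probability Omega R).
Variables (G : girg d n alpha theta1 theta2 D P).
Local Notation pr := (pr P).

(** The type of vertices varies with the outcome; on each slice it is a fixed finite type, where
    finite case distinctions apply. *)
Lemma measurable_by_num_vertices (S : set Omega) :
  (forall k, measurable ([set w | num_vertices G w = k] `&` S)) -> measurable S.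
Proof.
move=> mS; rewrite (_ : S = \bigcup_k ([set w | num_vertices G w = k] `&` S)).
  exact: bigcupT_measurable.
by apply/seteqP; split=> [w Sw|w [k _ []]//]; exists (num_vertices G w).
Qed.

Lemma measurable_position (A : set (d.-tuple R)) (v : nat) (b : bool) :
  measurable A -> measurable [set w | (position G v w \in A) = b].
Proof.
move=> mA; have mp : measurable (position G v @^-1` A).
  by rewrite -[X in measurable X]setTI; exact: measurable_funPT.
case: b; [rewrite [X in measurable X](_ : _ = position G v @^-1` A)//|
  rewrite [X in measurable X](_ : _ = ~` (position G v @^-1` A)); last first].
- by apply/seteqP; split=> w; [move=> /set_mem|move=> /mem_set].
- apply/seteqP; split=> w /=; first by move=> /negbT; rewrite notin_setE.
  by move=> nA; apply/negbTE; rewrite notin_setE.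
- exact: measurableC.
Qed.

Definition point_count (A : set (d.-tuple R)) (w : Omega) : nat :=
  (\sum_(v < num_vertices G w) (position G v w \in A))%N.

Lemma measurable_point_count A (S : set nat) : measurable A ->
  measurable [set w | S (point_count A w)].
Proof.
move=> mA; apply: measurable_by_num_vertices => k.
pose X w : {ffun 'I_k -> bool} := [ffun v : 'I_k => position G v w \in A].
rewrite (_ : _ `&` _ = [set w | num_vertices G w = k] `&`
    X @^-1` [set g : {ffun 'I_k -> bool} | S (\sum_(v < k) g v)%N]).
  apply: measurableI (measurable_num_vertices _ _) _.
  apply: measurable_fin_preim => g.
  rewrite [X in measurable X](_ : _ = [set w | forall v : 'I_k,
     [set w | (position G v w \in A) = g v] w]).
    by apply: measurable_forallT => v; exact: measurable_position.
  apply/seteqP; split=> w /=; first by move=> <- v; rewrite ffunE.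
  by move=> h; apply/ffunP => v; rewrite ffunE.
have E w : num_vertices G w = k -> point_count A w = (\sum_(v < k) X w v)%N.
  by rewrite /point_count => ->; apply: eq_bigr => v _; rewrite ffunE.
by apply/seteqP; split=> w [Nk]; rewrite /= E.
Qed.

Lemma pr_point_count A m : measurable A ->
  pr [set w | point_count A w = m] =
  poisson_mass (n%:R * fine (torus_volume R d A)) m.
Proof.
move=> mA; have := @poisson_process _ _ _ _ _ _ _ _ _ _ G 1 (fun=> A) (fun=> m).
rewrite big_ord1 => H; rewrite /pr (_ : [set w | _] = [set w | forall i : 'I_1,
  (\sum_(v < num_vertices G w) (position G v w \in A) = m)%N]).
  rewrite H//; apply/trivIsetP => i j _ _.
  by rewrite (ord1 i) (ord1 j) eqxx.
by apply/seteqP; split=> w //= /(_ ord0).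
Qed.

(** This is Markov's inequality for N (N - 1), whose mean is l^2 for a Poisson variable of mean l.
    The second order matters: summed over q'^d balls of mean about n / q'^d, a first moment bound
    would give n / a, which does not tend to 0 for a = n^(1 - rho). *)
Lemma pr_point_count_ge A a (lambda : R) : measurable A -> (2 <= a)%N ->
  n%:R * fine (torus_volume R d A) <= lambda ->
  pr [set w | (a <= point_count A w)%N] <= lambda ^+ 2 / (a%:R * a.-1%:R).
Proof.
move=> mA a2; set l := n%:R * _ => ll.
have l0 : 0 <= l by rewrite mulr_ge0// fine_ge0.
have aa : 0 < a%:R * a.-1%:R :> R.
  by rewrite mulr_gt0// ltr0n ?ltn_predRL// ltnW.
apply: (@le_trans _ _ (l ^+ 2 / (a%:R * a.-1%:R))); last first.
  by rewrite ler_wpM2r ?invr_ge0 ?(ltW aa)// lerXn2r ?nnegrE// (le_trans l0).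
rewrite (_ : mkset _ = ~` [set w | (point_count A w < a)%N]); last first.
  by apply/seteqP; split=> w /= h; [rewrite ltnNge h|rewrite leqNgt; apply/negP].
have mlt := measurable_point_count (fun x => (x < a)%N) mA.
rewrite pr_setC//.
have : \sum_(m < a) pr [set w | point_count A w = m] <= pr [set w | (point_count A w < a)%N].
  apply: pr_sum_le => //.
  - exact: index_enum_uniq.
  - by move=> m _; exact: (measurable_point_count (fun x => x = m)).
  - by move=> m _ w /= ->.
  - move=> m m' _ _ mm'; rewrite -subset0 => w [/= -> /val_inj h].
    by rewrite h eqxx in mm'.
under eq_bigr do rewrite pr_point_count//.
move=> H; have T := exp_tail_le l0 a2.
have e0 : 0 < expR (- l) by exact: expR_gt0.
have := ler_wpM2l (ltW e0) T; rewrite -expRD addNr expR0 mulrDr => H2.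
have S : \sum_(m < a) poisson_mass l m = expR (- l) * \sum_(0 <= m < a) l ^+ m / m`!%:R.
  rewrite big_mkord mulr_sumr; apply: eq_bigr => m _.
  by rewrite /poisson_mass mulrA.
have E : expR (- l) * (l ^+ 2 / (a%:R * a.-1%:R) * expR l) = l ^+ 2 / (a%:R * a.-1%:R).
  by rewrite mulrCA -expRD addNr expR0 mulr1.
rewrite -S E in H2; rewrite -/l in H; lra.
Qed.

End counting.

(** * Measurability of the number of informed vertices *)

Section informed_measurable.
Context (R : realType) (d n : nat) (alpha theta1 theta2 : R).
Context (D : probability R R) (disp : measure_display).
Context (Omega : measurableType disp) (P : probability Omega R).
Variables (G : girg d n alpha theta1 theta2 D P) (Q : push_pull G).

Definition informed_set k t w : {set 'I_k} :=
  @informed k (fun u v => edge G u v w) (start Q w) (fun r v => call Q r v w) t.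

Lemma measurable_informed_mem k t (v : 'I_k) :
  measurable [set w | v \in informed_set k t w].
Proof.
elim: t v => [|t IH] v.
  rewrite [X in measurable X](_ : _ = [set w | start Q w = v]).
    exact: measurable_start.
  by apply/seteqP; split=> w; rewrite /informed_set /= inE; [move=> /eqP|move=> ->].
rewrite [X in measurable X](_ : _ = [set w | v \in informed_set k t w] `|`
   [set w | exists u : 'I_k, ([set w | u \in informed_set k t w] `&`
       [set w | edge G u v w = true] `&`
       ([set w | call Q t u w = v] `|` [set w | call Q t v w = u])) w]).
  apply: measurableU => //.
  apply: (measurable_existsT (B := fun u : 'I_k => [set w | u \in informed_set k t w] `&`
       [set w | edge G u v w = true] `&`
       ([set w | call Q t u w = v] `|` [set w | call Q t v w = u]))) => u.
  apply: measurableI; first exact: measurableI (IH u) (measurable_edge _ _ _ _).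
  exact: measurableU (measurable_call _ _ _ _) (measurable_call _ _ _ _).
apply/seteqP; split=> w; rewrite /informed_set /= !inE.
  move=> /orP[?|/existsP[u /andP[uI /andP[uv c]]]]; [by left|right].
  by exists u; split; [split|case/orP: c => /eqP; [left|right]].
move=> [->//|[u [[uI uv] c]]]; apply/orP; right; apply/existsP; exists u.
by rewrite uI uv/=; case: c => /= ->; rewrite eqxx ?orbT.
Qed.

Lemma num_informedE k t w : num_vertices G w = k ->
  num_informed Q t w = #|informed_set k t w|.
Proof. by move=> <-. Qed.

Lemma measurable_num_informed t (S : set nat) :
  measurable [set w | S (num_informed Q t w)].
Proof.
apply: (measurable_by_num_vertices (G := G)) => k.
rewrite (_ : _ `&` _ = [set w | num_vertices G w = k] `&`
    (informed_set k t @^-1` [set I : {set 'I_k} | S #|I|])).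
  apply: measurableI (measurable_num_vertices _ _) _.
  apply: measurable_fin_preim => I.
  rewrite [X in measurable X](_ : _ = [set w | forall v : 'I_k,
     [set w | (v \in informed_set k t w) = (v \in I)] w]).
    apply: measurable_forallT => v; case: (v \in I).
      exact: measurable_informed_mem.
    rewrite [X in measurable X](_ : _ = ~` [set w | v \in informed_set k t w]).
      exact: measurableC (measurable_informed_mem _ _).
    by apply/seteqP; split=> w /=; [move=> ->|move=> /negP/negbTE].
  apply/seteqP; split=> w /=; first by move=> ->.
  by move=> h; apply/setP.
by apply/seteqP; split=> w [Nk]; rewrite /= (num_informedE _ Nk).
Qed.

End informed_measurable.

(** * Locality of the spread *)

Section spread.
Context (R : realType) (d n : nat) (alpha theta1 theta2 : R).
Context (D : probability R R) (disp : measure_display).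
Context (Omega : measurableType disp) (P : probability Omega R).
Variables (G : girg d n alpha theta1 theta2 D P) (Q : push_pull G).
Local Notation pr := (pr P).
Variable r0 : R.
Hypothesis r0_gt0 : 0 < r0.

(** Whether pushed or pulled, the rumour crosses an edge along which one end calls the other.
    Without far calls such an edge has length at most r0, so each round adds at most r0 by the
    triangle inequality. *)
Lemma informed_near T k w t (v : 'I_k) :
  num_vertices G w = k -> ~ far_call_event Q r0 T k w -> (t <= T)%N ->
  v \in informed_set Q k t w ->
  torus_dist (position G (start Q w) w) (position G v w) <= t%:R * r0.
Proof.
move=> Nk nfar; have Tp (i : 'I_k) : @torus R d (position G i w).
  by apply: position_torus; rewrite Nk.
have Ts : @torus R d (position G (start Q w) w).
  apply: position_torus; apply: start_vertex.
  by rewrite Nk (leq_ltn_trans _ (ltn_ord v)).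
elim: t v => [|t IH] v tT.
  by rewrite /informed_set /= inE => /eqP <-; rewrite torus_distxx mul0r.
rewrite /informed_set /= !inE => /orP[vI|/existsP[u /andP[uI /andP[uv c]]]].
  apply: (le_trans (IH _ (ltnW tT) vI)).
  by rewrite ler_wpM2r ?ler_nat// ltW.
have uvr : torus_dist (position G u w) (position G v w) <= r0.
  apply: contrapT => far; apply: nfar; split => //; case/orP: c => /eqP c.
    by exists (Ordinal tT, u, v).
  exists (Ordinal tT, v, u); split => //=; first by rewrite edge_sym.
  by rewrite torus_distC.
apply: (le_trans (torus_dist_triangle Ts (Tp u) (Tp v))).
by rewrite -natr1 mulrDl mul1r lerD// IH// ltnW.
Qed.

Definition grid_point q (c : {ffun 'I_d -> 'I_q}) : d.-tuple R :=
  [tuple (c i)%:R / q%:R | i < d].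

Lemma grid_point_torus q (c : {ffun 'I_d -> 'I_q}) : @torus R d (grid_point c).
Proof.
move=> i; rewrite tnth_mktuple; have q0 : (0 < q)%N by apply: leq_ltn_trans (ltn_ord (c i)).
by rewrite divr_ge0//= ltr_pdivrMr ?ltr0n// mul1r ltr_nat.
Qed.

Lemma grid_point_near q (c : {ffun 'I_d -> 'I_q}) x : cell c x ->
  torus_dist (grid_point c) x <= q%:R^-1.
Proof.
apply: cell_diam => i; rewrite tnth_mktuple lexx/=.
have q0 : (0 < q)%N by apply: leq_ltn_trans (ltn_ord (c i)).
by rewrite ltr_pM2r ?invr_gt0 ?ltr0n// ltr_nat.
Qed.

(** The centre is a grid point, as the start is random and a union bound needs deterministic sets.
    One 1/q of the radius covers the distance from the grid point to the start, the other the spread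
    of the rumour. *)
Definition grid_ball q (c : {ffun 'I_d -> 'I_q}) : set (d.-tuple R) :=
  [set x | torus_dist x (grid_point c) <= 2 * q%:R^-1].

Lemma num_informed_le_count T k q w : (0 < q)%N -> T%:R * r0 <= q%:R^-1 ->
  (0 < k)%N -> num_vertices G w = k -> ~ far_call_event Q r0 T k w ->
  exists c : {ffun 'I_d -> 'I_q}, (num_informed Q T w <=
    point_count G (grid_ball c) w)%N.
Proof.
move=> q0 Tr0 k0 Nk nfar.
have Ts : @torus R d (position G (start Q w) w).
  by apply: position_torus; apply: start_vertex; rewrite Nk.
have [c cs] := cell_cover q0 Ts; exists c.
rewrite (num_informedE _ _ Nk) /point_count Nk -sum1_card big_mkcond/=.
apply: leq_sum => v _; case: ifP => // vI.
rewrite mem_set// /grid_ball /= torus_distC.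
apply: (le_trans (torus_dist_triangle (grid_point_torus c) Ts _)).
  by apply: position_torus; rewrite Nk.
rewrite (_ : 2 * _ = q%:R^-1 + q%:R^-1); last by ring.
apply: lerD; first exact: grid_point_near.
exact: le_trans (informed_near Nk nfar (leqnn T) vI) Tr0.
Qed.

Hypotheses (n_gt0 : (0 < n)%N) (theta1_gt0 : 0 < theta1) (theta12 : theta1 <= theta2)
  (theta2_le1 : theta2 <= 1).
Variables (b beta : R) (L : nat) (q : nat -> nat).
Hypotheses (b_ge1 : 1 <= b) (beta_le : 0 < beta <= alpha).
Hypotheses (q_gt0 : forall i, (0 < q i)%N)
  (q_large : forall i, n%:R * (6 * (q i)%:R^-1) ^+ d <= b ^+ i).
Hypothesis D_low : D `]-oo, 1[%classic = 0%E.
Local Notation dW i := (fine (D (weight_class b i))).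
Local Notation fp i j := (far_prob d n theta1 theta2 b beta r0 i j).

(** The summands belong to three bad events: at least K vertices ([E1]), a far call ([E2]), an
    overfull grid ball ([E3]). The 12 is the volume constant 6 times the factor 2 in the radius. *)
Lemma pr_num_informed_ge T K a q' : (0 < q')%N -> (2 <= K)%N -> (2 <= a)%N ->
  T%:R * r0 <= q'%:R^-1 ->
  pr [set w | (a <= num_informed Q T w)%N] <=
    n%:R ^+ 2 / (K%:R * K.-1%:R) +
    (K%:R * (fine (D `[b ^+ L, +oo[%classic) +
      \sum_(i < L) \sum_(j < L) T%:R * (fp i j * (dW i * dW j) * (q i)%:R ^+ d)) +
    q'%:R ^+ d * ((n%:R * (12 * q'%:R^-1) ^+ d) ^+ 2 / (a%:R * a.-1%:R))).
Proof.
move=> q'0 K2 a2 Tr0.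
pose ball (c : {ffun 'I_d -> 'I_q'}) := grid_ball c.
have rq : 0 <= 2 * q'%:R^-1 :> R by rewrite mulr_ge0.
have mball c : measurable (ball c) by exact: measurable_torus_ball.
pose E1 := [set w | (K <= point_count G setT w)%N].
pose E2 := far_call_before Q r0 T K.
pose E3 := [set w | exists c, (a <= point_count G (ball c) w)%N].
have mT : measurable [set: d.-tuple R] by exact: measurableT.
have mE1 : measurable E1 by exact: (measurable_point_count G (fun x => (K <= x)%N) mT).
have mE2 : measurable E2.
  apply: (measurable_existsT (B := fun k : 'I_K => far_call_event Q r0 T k)) => k.
  exact: measurable_far_call_event.
have mE3c c : measurable [set w | (a <= point_count G (ball c) w)%N].
  exact: (measurable_point_count G (fun x => (a <= x)%N)).
have mE3 : measurable E3.
  exact: (measurable_existsT (B := fun c => [set w | (a <= point_count G (ball c) w)%N])).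
have mE : measurable [set w | (a <= num_informed Q T w)%N].
  exact: (measurable_num_informed Q T (fun x => (a <= x)%N)).
have m23 : measurable (E2 `|` E3) by exact: measurableU.
apply: (@le_trans _ _ (pr (E1 `|` (E2 `|` E3)))).
  apply: pr_mono => //; first exact: measurableU.
  move=> w aw; have [NK|NK] := leqP K (num_vertices G w).
    left; rewrite /E1 /point_count /= (eq_bigr (fun=> 1%N)).
      by rewrite sum1_card card_ord.
    by move=> v _; rewrite in_setT.
  right; have [far|nfar] := pselect (far_call_event Q r0 T (num_vertices G w) w).
    by left; exists (Ordinal NK).
  (* Without vertices there is no start position, but also no informed vertex, contrary to a >=
     2. *)
  right; have [N0|N0] := posnP (num_vertices G w).
    exfalso; move: aw => /=; rewrite (num_informedE _ _ N0) leqNgt.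
    rewrite (leq_ltn_trans (max_card _))// card_ord.
    exact: leq_trans a2.
  have [c hc] := num_informed_le_count q'0 Tr0 N0 erefl nfar.
  by exists c; exact: leq_trans hc.
apply: le_trans (pr_setU _ mE1 m23) _; apply: lerD.
  by apply: pr_point_count_ge => //; rewrite probability_setT mulr1.
apply: le_trans (pr_setU _ mE2 mE3) _; apply: lerD.
  exact: pr_far_call_before.
apply: (@le_trans _ _ (\sum_(c : {ffun 'I_d -> 'I_q'})
   pr [set w | (a <= point_count G (ball c) w)%N])).
  by apply: pr_cover_le => // w [c ?]; exists c; rewrite mem_index_enum.
apply: (@le_trans _ _ (\sum_(c : {ffun 'I_d -> 'I_q'})
   (n%:R * (12 * q'%:R^-1) ^+ d) ^+ 2 / (a%:R * a.-1%:R))).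
  apply: ler_sum => c _; apply: pr_point_count_ge => //.
  rewrite ler_wpM2l// -lee_fin fineK ?fin_num_measure//.
  rewrite (_ : 12 * q'%:R^-1 = 6 * (2 * q'%:R^-1)); last by rewrite mulrA -natrM.
  by apply: torus_ball_volume_le => //; exact: grid_point_torus.
by rewrite sumr_const card_ffun !card_ord -[leLHS]mulr_natl natrX.
Qed.

End spread.

(** * Choice of the exponents *)

Section parameters.
Variable R : realType.
Implicit Types (tau alpha x y : R).

(** phi + 1 = (3 + sqrt 5) / 2 is the larger root of t^2 - 3t + 1, and (2 tau - 3)^2 - 5 is four
    times this polynomial at tau. *)
Lemma golden_ratio_sq tau : golden_ratio R + 1 < tau -> 2 < tau /\ 0 < tau ^+ 2 - 3 * tau + 1.
Proof.
rewrite /golden_ratio => h; set r := Num.sqrt 5 in h.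
have r5 : r ^+ 2 = 5 by rewrite sqr_sqrtr.
have r0 : 0 <= r by exact: sqrtr_ge0.
have r2 : 2 <= r.
  by rewrite leNgt; apply/negP => r2; nra.
split; first lra.
have : 0 < (2 * tau - 3) ^+ 2 - r ^+ 2 by rewrite subr_sqr; apply: mulr_gt0; lra.
by rewrite r5; lra.
Qed.

(* The expected number of far calls has exponent 1 + beta / (tau - 1) - beta, which
   is negative for beta > (tau - 1) / (tau - 2), while beta < tau keeps the sum over
   the weight of the caller bounded. The two constraints are compatible exactly
   when tau^2 - 3 tau + 1 > 0, that is tau > phi + 1. *)
Lemma exponent_choice tau alpha : golden_ratio R + 1 < tau -> tau < 3 ->
  (tau - 1) / (tau - 2) < alpha ->
  exists beta, [/\ tau - 1 < beta, beta < tau, beta <= alpha &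
    0 < beta - 1 - beta / (tau - 1)].
Proof.
move=> tg t3; have [t2 tq] := golden_ratio_sq tg.
set l := _ / _ => la.
(* After clearing denominators, l < tau is tau^2 - 3 tau + 1 > 0, and tau - 1 < l below is tau < 3.
   The witness is the midpoint of l and min(alpha, tau). *)
have lt : l < tau by rewrite ltr_pdivrMr; nra.
have lE : l * (tau - 2) = tau - 1 by rewrite mulfVK//; apply/eqP; lra.
have sl : tau - 1 < l by rewrite ltr_pdivlMr; nra.
pose m := Num.min alpha tau.
have lm : l < m by rewrite lt_min la lt.
have ma : m <= alpha by rewrite ge_min lexx.
have mt : m <= tau by rewrite ge_min lexx orbT.
exists ((l + m) / 2); split; [lra|lra|lra|].
have s0 : 0 < tau - 1 by lra.
rewrite subr_gt0 ltr_pdivrMr//; set be := _ / 2.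
have lb : l < be by rewrite /be; lra.
nra.
Qed.

Lemma truncn_gt x : x < (Num.truncn x)%:R + 1.
Proof. by rewrite natr1; exact: truncnS_gt. Qed.

Lemma truncn_le_real x : 0 <= x -> (Num.truncn x)%:R <= x.
Proof. by move=> x0; rewrite truncn_le. Qed.

Lemma powR_ge1 x y : 1 <= x -> 0 <= y -> 1 <= x `^ y.
Proof. by move=> x1 y0; rewrite -(powRr0 x) ler_powR. Qed.

Lemma powRDr x y z : 0 < x -> x `^ (y + z) = x `^ y * x `^ z.
Proof. by move=> x0; rewrite powRD// (gt_eqF x0) implybT. Qed.

Lemma powR_exprn x y (i : nat) : (x `^ y) ^+ i = x `^ (y * i%:R).
Proof. by rewrite powRrM powR_mulrn// powR_ge0. Qed.

End parameters.

(** * Exponents of the summands *)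

Section summand.
Context (R : realType) (d n : nat) (theta1 theta2 tau beta u eps C b r0 : R) (L : nat).
Context (D : probability R R).
Local Notation x := (n%:R : R).
Hypotheses (n_gt0 : (0 < n)%N) (theta1_gt0 : 0 < theta1) (theta2_gt0 : 0 < theta2)
  (u_gt0 : 0 < u) (eps_gt0 : 0 < eps) (eps_le : eps <= u) (s_gt1 : 1 < tau - 1)
  (beta_gt : tau - 1 < beta) (beta_lt : beta < tau)
  (epsL : eps * L%:R = (1 + 2 * u) / (tau - 1))
  (u_le : u * (3 + 4 * beta + 2 * d%:R * beta) <= (beta - 1 - beta / (tau - 1)) / 2)
  (C_gt0 : 0 < C) (tailC : forall y, 1 <= y -> fine (D `[y, +oo[%classic) <= C * y `^ (1 - tau))
  (bE : b = x `^ eps) (r0_gt0 : 0 < r0) (r0_ge : 2^-1 * x `^ (- (2 * u)) <= r0).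

Let x1 : 1 <= x. Proof. by rewrite ler1n. Qed.
Let x0 : 0 < x. Proof. by rewrite ltr0n. Qed.
Let b1 : 1 <= b. Proof. by rewrite bE powR_ge1// ltW. Qed.
Let bX i : b ^+ i = x `^ (eps * i%:R). Proof. by rewrite bE powR_exprn. Qed.

Lemma weight_class_le i :
  fine (D (weight_class b i)) <= C * x `^ (- (eps * i%:R * (tau - 1))).
Proof.
apply: (@le_trans _ _ (fine (D `[b ^+ i, +oo[%classic))).
  apply: pr_mono; [exact: measurable_itv|exact: measurable_itv|].
  by move=> y; rewrite /weight_class /= !in_itv/= => /andP[->].
apply: (le_trans (tailC _)); first by rewrite exprn_ege1.
by rewrite bX -powRrM -mulrN opprB.
Qed.

(** The lower bound on r0 gives 1 / r0^d <= 2^d n^(2du), whence the factor (2^d)^beta and the error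
    2du in the exponent. *)
Lemma far_prob_le i j : far_prob d n theta1 theta2 b beta r0 i j <=
  3 * theta2 / theta1 * (2 ^+ d) `^ beta *
    x `^ (beta * (eps * (i.+1)%:R + eps * (j.+1)%:R - 1 + 2 * d%:R * u)).
Proof.
rewrite /far_prob -[leRHS]mulrA ler_wpM2l ?divr_ge0 ?mulr_ge0 ?(ltW theta1_gt0) ?(ltW theta2_gt0)//.
have beta0 : 0 <= beta by have := beta_gt; have := s_gt1; lra.
rewrite (mulrC beta) powRrM -powRM ?exprn_ge0 ?powR_ge0//.
have rd0 : 0 < r0 ^+ d by rewrite exprn_gt0.
apply: ge0_ler_powR => //; rewrite ?nnegrE.
- have b0 : 0 <= b by exact: le_trans b1.
  by rewrite divr_ge0 ?mulr_ge0 ?exprn_ge0 ?(ltW r0_gt0).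
- by rewrite mulr_ge0 ?exprn_ge0 ?powR_ge0.
rewrite !bX ler_pdivrMr ?mulr_gt0//.
have rd : 2^-1 ^+ d * x `^ (- (2 * d%:R * u)) <= r0 ^+ d.
  rewrite (_ : - (2 * d%:R * u) = - (2 * u) * d%:R); last by ring.
  rewrite -powR_exprn -exprMn.
  have h0 : 0 <= 2^-1 * x `^ (- (2 * u)) by rewrite mulr_ge0 ?invr_ge0 ?powR_ge0.
  by apply: lerXn2r => //; rewrite nnegrE ltW.
rewrite !powRDr// !powRN powRr1 ?(ltW x0)//.
set A := x `^ (eps * i.+1%:R); set B := x `^ (eps * j.+1%:R); set V := x `^ (2 * d%:R * u).
have V0 : 0 < V by exact: powR_gt0.
have A0 : 0 <= A by exact: powR_ge0.
have B0 : 0 <= B by exact: powR_ge0.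
rewrite (_ : 2 ^+ d * (A * B / x * V) * (x * r0 ^+ d) = (A * B) * (2 ^+ d * V * r0 ^+ d)); last first.
  by field; rewrite gt_eqF.
rewrite ler_peMr ?mulr_ge0//; move: rd; rewrite powRN -/V exprVn.
by rewrite -invfM -[X in X <= _]mulr1 ler_pdivrMl// mulr_gt0 ?exprn_gt0.
Qed.

(** The exponent is linear in eps i with slope beta - tau < 0 and in eps j with slope beta - (tau -
    1) > 0. The worst case is a caller of constant weight and a called vertex of the largest weight
    considered, eps j = (1 + 2u) / (tau - 1). The main term is then 1 + beta / (tau - 1) - beta, and
    [u_le] pays for everything of order u. *)
Lemma exponent_le i j : (j < L)%N ->
  (1 + u) + (u + (beta * (eps * (i.+1)%:R + eps * (j.+1)%:R - 1 + 2 * d%:R * u)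
    + (- (eps * i%:R * (tau - 1)) + - (eps * j%:R * (tau - 1))) + (1 - eps * i%:R)))
  <= - u.
Proof.
move=> jL; have s0 : 0 < tau - 1 by have := s_gt1; lra.
have h0 := u_le; set bs := beta / (tau - 1) in h0 *.
have bsE : bs * (tau - 1) = beta by rewrite mulfVK// gt_eqF.
have beta0 : 0 < beta by have := beta_gt; lra.
have bs_le : bs <= beta by rewrite ler_pdivrMr//; have := s_gt1; nra.
have iA : 0 <= eps * i%:R by rewrite mulr_ge0// ltW.
have jB : 0 <= eps * j%:R by rewrite mulr_ge0// ltW.
have jLe : eps * j%:R <= (1 + 2 * u) / (tau - 1).
  by rewrite -epsL ler_pM2l// ler_nat ltnW.
have hA : eps * i%:R * (beta - tau) <= 0 by apply: mulr_ge0_le0 => //; have := beta_lt; lra.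
have hB : eps * j%:R * (beta - (tau - 1)) <= (1 + 2 * u) * (bs - 1).
  apply: (@le_trans _ _ ((1 + 2 * u) / (tau - 1) * (beta - (tau - 1)))).
    by rewrite ler_wpM2r// ltW// subr_gt0.
  rewrite -mulrA ler_wpM2l//; first by have := u_gt0; lra.
  by rewrite mulrBr mulVf ?gt_eqF// mulrC.
have hE : beta * eps <= beta * u by rewrite ler_pM2l.
have hbs : u * bs <= u * beta by rewrite ler_pM2l.
have hu := u_gt0.
rewrite -[i.+1]addn1 -[j.+1]addn1 !natrD.
set ei := eps * i%:R in iA hA *; set ej := eps * j%:R in jB hB *.
rewrite (_ : eps * (i%:R + 1) = ei + eps); last by rewrite /ei; ring.
rewrite (_ : eps * (j%:R + 1) = ej + eps); last by rewrite /ej; ring.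
have hp : 0 <= u * (3 + 4 * beta + 2 * d%:R * beta).
  by rewrite mulr_ge0 ?addr_ge0 ?mulr_ge0 ?(ltW beta0) ?(ltW hu).
lra.
Qed.

Lemma summand_le (K T q i j : nat) : (j < L)%N ->
  K%:R <= 3 * x `^ (1 + u) -> T%:R <= x `^ u ->
  q%:R ^+ d <= 7 ^+ d * x `^ (1 - eps * i%:R) ->
  K%:R * (T%:R * (far_prob d n theta1 theta2 b beta r0 i j *
     (fine (D (weight_class b i)) * fine (D (weight_class b j))) * q%:R ^+ d)) <=
  3 * (3 * theta2 / theta1 * (2 ^+ d) `^ beta * (C * C) * 7 ^+ d) * x `^ (- u).
Proof.
move=> jL hK hT hq.
have hfp := far_prob_le i j; have hi := weight_class_le i; have hj := weight_class_le j.
have fp0 : 0 <= far_prob d n theta1 theta2 b beta r0 i j.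
  by rewrite mulr_ge0 ?powR_ge0// divr_ge0 ?mulr_ge0 ?(ltW theta1_gt0) ?(ltW theta2_gt0).
have Wi0 : 0 <= fine (D (weight_class b i)) by rewrite fine_ge0.
have Wj0 : 0 <= fine (D (weight_class b j)) by rewrite fine_ge0.
have Wij := ler_pM Wi0 Wj0 hi hj.
have FW := ler_pM fp0 (mulr_ge0 Wi0 Wj0) hfp Wij.
have FWq := ler_pM (mulr_ge0 fp0 (mulr_ge0 Wi0 Wj0)) (exprn_ge0 d (ler0n R q)) FW hq.
have P0 := mulr_ge0 (mulr_ge0 fp0 (mulr_ge0 Wi0 Wj0)) (exprn_ge0 d (ler0n R q)).
have TFWq := ler_pM (ler0n R T) P0 hT FWq.
have := ler_pM (ler0n R K) (mulr_ge0 (ler0n R T) P0) hK TFWq.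
move=> /le_trans; apply.
set c0 := 3 * theta2 / theta1 * (2 ^+ d) `^ beta.
have c00 : 0 <= c0 by rewrite mulr_ge0 ?powR_ge0// divr_ge0 ?mulr_ge0 ?(ltW theta1_gt0) ?(ltW theta2_gt0).
apply: (@le_trans _ _ (3 * (c0 * (C * C) * 7 ^+ d) * x `^ ((1 + u) + (u + (beta * (eps * (i.+1)%:R + eps * (j.+1)%:R - 1 + 2 * d%:R * u)
    + (- (eps * i%:R * (tau - 1)) + - (eps * j%:R * (tau - 1))) + (1 - eps * i%:R)))))).
  have pw e1 e2 e3 e4 e5 e6 : x `^ (e1 + (e2 + (e3 + (e4 + e5) + e6))) =
      x `^ e1 * (x `^ e2 * (x `^ e3 * (x `^ e4 * x `^ e5) * x `^ e6)).
    by rewrite !(powRDr _ _ x0).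
  rewrite pw.
  by rewrite le_eqVlt; apply/orP; left; apply/eqP; ring.
rewrite ler_wpM2l//.
  have C0 := ltW C_gt0.
  by rewrite mulr_ge0// mulr_ge0 ?exprn_ge0// mulr_ge0// mulr_ge0.
by rewrite ler_powR// exponent_le.
Qed.

End summand.

(** * The bound for fixed n *)

Section asymptotics.
Context (R : realType) (d : nat) (tau alpha theta1 theta2 : R).
Context (D : probability R R).
Hypotheses (d_gt0 : (0 < d)%N) (theta1_gt0 : 0 < theta1) (theta12 : theta1 <= theta2)
  (theta2_le1 : theta2 <= 1).
Variables (beta u eps C : R) (L : nat).
Hypotheses (u_gt0 : 0 < u) (eps_gt0 : 0 < eps) (eps_le : eps <= u) (s_gt1 : 1 < tau - 1)
  (u_s : 2 * u <= tau - 1 - 1) (du : d%:R * u <= 4)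
  (beta_gt : tau - 1 < beta) (beta_lt : beta < tau) (beta_alpha : beta <= alpha)
  (epsL : eps * L%:R = (1 + 2 * u) / (tau - 1))
  (u_le : u * (3 + 4 * beta + 2 * d%:R * beta) <= (beta - 1 - beta / (tau - 1)) / 2)
  (C_gt0 : 0 < C) (tailC : forall y, 1 <= y -> fine (D `[y, +oo[%classic) <= C * y `^ (1 - tau))
  (D_low : D `]-oo, 1[%classic = 0%E).

(** A grid ball has mean of order n^(1 - du). Allowing n^(1 - rho) vertices, the second moment bound
    over n^(du) balls has exponent du + 2 (1 - du) - 2 (1 - rho) = 2 rho - du, which is - du / 2 for
    this choice. *)
Definition rho : R := d%:R * u / 4.

(** One summand per bad event: too many vertices; a weight of at least b^L or one of the L^2 class
    pairs; an overfull ball, with 144 = 12^2 and the 2 from a (a - 1) >= y^2 / 2. *)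
Definition bound_const : R :=
  1 + (3 * C + L%:R * (L%:R * (3 * (3 * theta2 / theta1 * (2 ^+ d) `^ beta * (C * C) * 7 ^+ d)))) +
    2 * 144 ^+ d.

Lemma pr_many_informed n (disp : measure_display) (Omega : measurableType disp)
    (P : probability Omega R) (G : girg d n alpha theta1 theta2 D P) (Q : push_pull G) :
  (0 < n)%N ->
  pr P [set w | (Num.truncn (n%:R `^ (1 - rho) : R) <
                 num_informed Q (Num.truncn (n%:R `^ u : R)) w)%N]
    <= bound_const * n%:R `^ (- (u / 2)).
Proof.
move=> n_gt0; set x : R := n%:R.
have x1 : 1 <= x by rewrite ler1n.
have x0 : 0 < x by rewrite ltr0n.
have d0 : 0 < d%:R :> R by rewrite ltr0n.
have d1 : 1 <= d%:R :> R by rewrite ler1n.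
have theta2_gt0 : 0 < theta2 by exact: lt_le_trans theta12.
have uu := u_gt0.
pose b := x `^ eps.
have b1 : 1 <= b by rewrite powR_ge1// ltW.
have bX i : b ^+ i = x `^ (eps * i%:R) by rewrite /b powR_exprn.
(* With [.+2] also K - 1 exceeds n^(1 + u), so that n^2 / (K (K - 1)) <= n^(- 2u). *)
pose K := (Num.truncn (x `^ (1 + u))).+2.
pose T := Num.truncn (x `^ u).
pose q' := (Num.truncn (x `^ u)).+1.
pose a := (Num.truncn (x `^ (1 - rho))).+1.
(* As T <= n^u, this is a value with T r0 <= 1 / q'; and q' <= 2 n^u keeps it above n^(- 2u) / 2. *)
pose r0 : R := (x `^ u * q'%:R)^-1.
pose z i : R := (x / b ^+ i) `^ d%:R^-1.
(* z i is the solution of z^d = n / b^i; the 6 cancels the volume constant in [q_large]. *)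
pose q i := (Num.truncn (6 * z i)).+1.
have xu1 : 1 <= x `^ u by rewrite powR_ge1// ltW.
have q'0 : 0 < q'%:R :> R by rewrite ltr0n.
have q'lo : x `^ u <= q'%:R by rewrite ltW// /q' truncnS_gt.
have q'hi : q'%:R <= 2 * x `^ u.
  have := truncn_le_real (le_trans ler01 xu1); rewrite /q' -natr1; lra.
have r0_gt0 : 0 < r0 by rewrite invr_gt0 mulr_gt0// (lt_le_trans ltr01).
have Tr0 : T%:R * r0 <= q'%:R^-1.
  rewrite /r0 invfM mulrA ler_piMl ?invr_ge0// ler_pdivrMr ?(lt_le_trans ltr01)// mul1r.
  by apply: truncn_le_real; exact: powR_ge0.
have r0_ge : 2^-1 * x `^ (- (2 * u)) <= r0.
  rewrite powRN -invfM /r0 lef_pV2 ?posrE ?mulr_gt0 ?powR_gt0//.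
  rewrite (_ : 2 * u = u + u); last by ring.
  by rewrite powRDr// mulrCA ler_wpM2l ?powR_ge0.
have b0 i : 0 < b ^+ i by rewrite exprn_gt0// (lt_le_trans ltr01).
have xb i : 0 < x / b ^+ i by rewrite divr_gt0.
have z0 i : 0 < z i by rewrite powR_gt0.
have zd i : z i ^+ d = x / b ^+ i.
  by rewrite /z powR_exprn mulVf ?powRr1 ?gt_eqF ?ltW.
have q_large i : x * (6 * (q i)%:R^-1) ^+ d <= b ^+ i.
  have h : 6 * (q i)%:R^-1 <= (z i)^-1.
    rewrite ler_pdivrMr ?ltr0n// ler_pdivlMl// (mulrC (z i)).
    by rewrite ltW// /q truncnS_gt.
  have h2 : (6 * (q i)%:R^-1) ^+ d <= (z i)^-1 ^+ d.
    by apply: lerXn2r h; rewrite nnegrE ?mulr_ge0 ?invr_ge0 ?(ltW (z0 i)).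
  apply: (le_trans (ler_wpM2l (ltW x0) h2)).
  by rewrite exprVn zd invf_div mulrC divfK// gt_eqF.
(* All class bounds stay below n by [u_s], so z i >= 1 and rounding up 6 z i costs at most one
   further z i: the origin of the 7. *)
have bix i : (i < L)%N -> b ^+ i <= x.
  move=> iL; rewrite bX -[leRHS](powRr1 (ltW x0)) ler_powR//.
  apply: (@le_trans _ _ (eps * L%:R)); first by rewrite ler_pM2l// ler_nat ltnW.
  have s1 := s_gt1; have su := u_s.
  rewrite epsL ler_pdivrMr ?mul1r; lra.
have q_hi i : (i < L)%N -> (q i)%:R ^+ d <= 7 ^+ d * x `^ (1 - eps * i%:R).
  move=> iL; have z1 : 1 <= z i.
    by apply: powR_ge1; [rewrite ler_pdivlMr// mul1r bix|rewrite invr_ge0].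
  have q7 : (q i)%:R <= 7 * z i.
    have z60 : 0 <= 6 * z i by rewrite mulr_ge0// ltW.
    have := truncn_le_real z60; rewrite /q -natr1; lra.
  rewrite powRDr// powRr1 ?(ltW x0)// powRN -bX -zd -exprMn.
  by apply: lerXn2r q7; rewrite nnegrE// mulr_ge0// ltW.
have x1u : 1 <= x `^ (1 + u) by rewrite powR_ge1//; lra.
have K_hi : K%:R <= 3 * x `^ (1 + u).
  have := truncn_le_real (le_trans ler01 x1u).
  by rewrite /K -[_.+2]addn2 natrD; lra.
have K_lo : x `^ (1 + u) <= K.-1%:R by rewrite ltW// /K /= truncnS_gt.
have rho_le : rho <= 1 by rewrite /rho ler_pdivrMr// mul1r.
have rho0 : 0 < rho by rewrite divr_gt0// mulr_gt0.
pose y := x `^ (1 - rho).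
have y1 : 1 <= y by rewrite powR_ge1// subr_ge0.
have ty : (0 < Num.truncn y)%N by rewrite truncn_gt0.
have a2 : (2 <= a)%N by rewrite /a ltnS.
(* With t the truncation of y, a (a - 1) = (t + 1) t is at least (t + 1)^2 / 2 because t >= 1. *)
have aa : y ^+ 2 / 2 <= a%:R * a.-1%:R.
  have t1 : 1 <= (Num.truncn y)%:R :> R by rewrite ler1n.
  have t2 := truncn_gt y.
  have -> : a%:R = (Num.truncn y)%:R + 1 :> R by rewrite /a -natr1.
  set t : R := (Num.truncn y)%:R in t1 t2 *.
  have y2 : y ^+ 2 <= (t + 1) ^+ 2 by apply: lerXn2r; rewrite ?nnegrE; lra.
  have tt : 0 <= (t + 1) * (t - 1) by apply: mulr_ge0; lra.
  by rewrite !expr2 in y2 *; lra.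
have beta0 : 0 < beta <= alpha.
  by rewrite beta_alpha andbT; have := beta_gt; have := s_gt1; lra.
have K2 : (2 <= K)%N by [].
have main := @pr_num_informed_ge R d n alpha theta1 theta2 D disp Omega P G Q r0 r0_gt0
  n_gt0 theta1_gt0 theta12 theta2_le1 b beta L q b1 beta0 (fun i => ltn0Sn _) q_large
  D_low T K a q' isT K2 a2 Tr0.
rewrite addrA in main; apply: (le_trans main); rewrite /bound_const [leRHS]mulrDl [X in _ <= X + _]mulrDl -/x.
(* The three parts decay with exponents - 2u, - u and - du / 2; all are at most - u / 2 since d >=
   1. *)
have half e : e <= - (u / 2) -> x `^ e <= x `^ (- (u / 2)) by move=> he; rewrite ler_powR.
apply: lerD; first apply: lerD.
- rewrite mul1r; apply: (@le_trans _ _ (x `^ (- (2 * u)))); last by apply: half; lra.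
  rewrite (_ : - (2 * u) = 2%:R - ((1 + u) + (1 + u))); last by ring.
  rewrite powRDr// powR_mulrn ?(ltW x0)// ler_wpM2l ?exprn_ge0 ?(ltW x0)//.
  rewrite powRN lef_pV2 ?posrE ?mulr_gt0 ?powR_gt0 ?ltr0n//.
  rewrite powRDr// ler_pM ?powR_ge0//.
  by apply: (le_trans K_lo); rewrite ler_nat leq_pred.
- rewrite [leLHS]mulrDr [leRHS]mulrDl; apply: lerD.
    have tl : fine (D `[b ^+ L, +oo[%classic) <= C * x `^ (- (1 + 2 * u)).
      apply: (le_trans (tailC _)); first by rewrite exprn_ege1.
      rewrite bX epsL -powRrM (_ : _ * (1 - tau) = - (1 + 2 * u))//.
      have s0 : tau - 1 != 0 by rewrite gt_eqF// (lt_trans ltr01).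
      by field.
    apply: (@le_trans _ _ (3 * x `^ (1 + u) * (C * x `^ (- (1 + 2 * u))))).
      by apply: ler_pM => //; exact: fine_ge0.
    rewrite mulrACA -powRDr// ler_wpM2l ?mulr_ge0 ?(ltW C_gt0)//.
    by apply: half; lra.
  rewrite mulr_sumr -[leRHS]mulrA -[X in _ <= L%:R * X]mulrA; set c3 := (X in L%:R * (L%:R * X)).
  have inner i j : (i < L)%N -> (j < L)%N ->
    K%:R * (T%:R * (far_prob d n theta1 theta2 b beta r0 i j *
     (fine (D (weight_class b i)) * fine (D (weight_class b j))) * (q i)%:R ^+ d)) <= c3.
    move=> iL jL; have := @summand_le R d n theta1 theta2 tau beta u eps C b r0 L D n_gt0
      theta1_gt0 theta2_gt0 u_gt0 eps_gt0 eps_le s_gt1 beta_gt beta_lt epsL u_le C_gt0 tailC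
      erefl r0_gt0 r0_ge K T (q i) i j jL K_hi (truncn_le_real (powR_ge0 _ _)) (q_hi i iL).
    move=> /le_trans; apply; rewrite /c3; apply: ler_wpM2l; last by apply: half; lra.
    have C0 := ltW C_gt0.
    rewrite mulr_ge0// mulr_ge0 ?exprn_ge0// mulr_ge0//; last exact: mulr_ge0.
    by rewrite mulr_ge0 ?powR_ge0// divr_ge0 ?(ltW theta1_gt0)// mulr_ge0// ltW.
  rewrite -[X in X%:R * _]card_ord mulr_natl -sumr_const; apply: ler_sum => i _.
  rewrite mulr_sumr -[X in X%:R * _]card_ord mulr_natl -sumr_const; apply: ler_sum => j _.
  exact: inner.
- apply: (@le_trans _ _ (2 * 144 ^+ d * x `^ (- (d%:R * u / 2)))); last first.
    rewrite ler_wpM2l ?mulr_ge0 ?exprn_ge0//; apply: half.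
    by rewrite lerN2 ler_pM2r// ler_peMl// ltW.
  have qd : 0 < q'%:R ^+ d :> R by rewrite exprn_gt0.
  have e : q'%:R ^+ d * ((x * (12 * q'%:R^-1) ^+ d) ^+ 2 / (a%:R * a.-1%:R)) =
      144 ^+ d * (x ^+ 2 * ((q'%:R ^+ d)^-1 * (a%:R * a.-1%:R)^-1)).
    rewrite (_ : 144 = 12 * 12 :> R); last by rewrite -natrM.
    rewrite !exprMn exprVn; set A := (a%:R * _)^-1; set QQ := q'%:R ^+ d in qd *.
    set W := 12 ^+ d; field; exact: lt0r_neq0.
  rewrite e (mulrC 2) -[leRHS]mulrA ler_wpM2l ?exprn_ge0//.
  have y0 : 0 < y by lra.
  apply: (@le_trans _ _ (x ^+ 2 * (x `^ (- (d%:R * u)) * (y ^+ 2 / 2)^-1))).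
    rewrite ler_wpM2l ?exprn_ge0 ?(ltW x0)//; apply: ler_pM.
    - by rewrite invr_ge0 ltW.
    - by rewrite invr_ge0 mulr_ge0.
    - rewrite powRN lef_pV2 ?posrE ?powR_gt0//.
      rewrite (mulrC d%:R) -powR_exprn; apply: lerXn2r => //; rewrite nnegrE ?powR_ge0//.
    - rewrite lef_pV2 ?posrE//; first by apply: lt_le_trans aa; rewrite divr_gt0// exprn_gt0.
      by rewrite divr_gt0// exprn_gt0.
  rewrite invf_div /y powR_exprn.
  rewrite (_ : 2 / x `^ ((1 - rho) * 2%:R) = 2 * x `^ (- ((1 - rho) * 2%:R))); last by rewrite powRN.
  rewrite -powR_mulrn ?(ltW x0)// mulrCA mulrA mulrCA -mulrA -!powRDr//.
  rewrite le_eqVlt; apply/orP; left; apply/eqP; congr (_ * _ `^ _).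
  by rewrite /rho; field.
Qed.

End asymptotics.

(** * Passage to the limit and choice of the parameters *)

Lemma cvg_probability1 (R : realType) (c e : R) (f : nat -> R) :
  0 <= c -> 0 < e ->
  (forall n, (0 < n)%N -> 1 - c * n%:R `^ (- e) <= f n <= 1) ->
  (f n)%:E @[n --> \oo] --> 1%E.
Proof.
move=> c0 e0 fb; apply: cvg_EFin; first by near=> n.
apply/cvgrPdist_le => z z0; near=> n.
have n0 : (0 < n)%N by near: n; exact: nbhs_infty_gt.
have /andP[lo hi] := fb _ n0.
rewrite ger0_norm ?subr_ge0// lerBlDr -lerBlDl.
apply: le_trans lo; rewrite lerB//.
have n0R : 0 < n%:R :> R by rewrite ltr0n.
rewrite powRN ler_pdivrMr ?powR_gt0// -ler_pdivrMl//.
apply: (@le_trans _ _ (((z^-1 * c) `^ e^-1) `^ e)).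
  by rewrite -powRrM mulVf ?gt_eqF// powRr1// mulr_ge0 ?invr_ge0// ltW.
apply: ge0_ler_powR; rewrite ?nnegrE ?powR_ge0 ?(ltW e0)//.
by near: n; exact: nbhs_infty_ger.
Unshelve. all: by end_near.
Qed.

Theorem theorem2p3 (R : realType) (d : nat) (tau alpha theta1 theta2 : R)
    (D : probability R R)
    (d_gt0 : (0 < d)%N)
    (tau_gt : golden_ratio R + 1 < tau) (tau_lt : tau < 3)
    (alpha_gt : (tau - 1) / (tau - 2) < alpha)
    (theta1_gt0 : 0 < theta1) (theta1_le : theta1 <= theta2)
    (theta2_le : theta2 <= 1)
    (D_power : power_law tau D) :
  exists rho1 rho2 C : R, [/\ 0 < rho1, 0 < rho2, 0 < C &
    forall (disp : nat -> measure_display)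
      (Omega : forall n, measurableType (disp n))
      (P : forall n, probability (Omega n) R)
      (G : forall n, girg d n alpha theta1 theta2 D (P n))
      (Q : forall n, push_pull (G n)),
    P n [set w | (num_informed (Q n) (Num.truncn (n%:R `^ rho2 : R)) w)%:R
                   <= C * n%:R `^ (1 - rho1)] @[n --> \oo] --> 1%E].
Proof.
have [tau2 _] := golden_ratio_sq tau_gt.
have [beta [beta_gt beta_lt beta_alpha Delta_gt0]] := exponent_choice tau_gt tau_lt alpha_gt.
have [C C_gt0 tailC] := power_law_tail tau2 D_power.
have D_low := power_law_low D_power.
have d1 : 1 <= d%:R :> R by rewrite ler1n.
set Delta := beta - 1 - _ in Delta_gt0.
have s0 : 0 < tau - 1 by lra.
have beta0 : 0 < beta by lra.
pose M := 3 + 4 * beta + 2 * d%:R * beta.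
have db : beta <= d%:R * beta by rewrite ler_peMl// ltW.
have M_gt0 : 0 < M by rewrite /M; lra.
(* M is the coefficient of u in [u_le], which thus holds with equality; half of Delta remains as
   reserve. *)
pose u := Delta / 2 / M.
have uM : u * M = Delta / 2 by rewrite divfK// gt_eqF.
have u_gt0 : 0 < u by rewrite !divr_gt0.
have bs0 : 0 < beta / (tau - 1) by rewrite divr_gt0.
have bs1 : beta / (tau - 1) * (tau - 1) = beta by rewrite divfK// gt_eqF.
have ub : u * beta <= Delta / 8 by move: uM; rewrite /M; nra.
have udb : u * (d%:R * beta) <= Delta / 4 by move: uM; rewrite /M; nra.
have Delta_le : Delta <= beta * (tau - 1 - 1) by rewrite /Delta; nra.
have u_s : 2 * u <= tau - 1 - 1.
  by rewrite -(ler_pM2l beta0); lra.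
have du : d%:R * u <= 4.
  rewrite -(ler_pM2l beta0); have : Delta <= beta by rewrite /Delta; lra.
  by lra.
(* L is taken first, large enough that dividing the exponent of the weight cutoff into L equal steps
   gives steps eps <= u. *)
pose L := (Num.truncn ((1 + 2 * u) / (tau - 1) / u)).+1.
pose eps := (1 + 2 * u) / (tau - 1) / L%:R.
have v0 : 0 < (1 + 2 * u) / (tau - 1) by rewrite divr_gt0//; lra.
have L0 : 0 < L%:R :> R by rewrite ltr0n.
have eps_gt0 : 0 < eps by rewrite divr_gt0.
have epsL : eps * L%:R = (1 + 2 * u) / (tau - 1) by rewrite divfK// gt_eqF.
have eps_le : eps <= u.
  rewrite ler_pdivrMr// (mulrC u) -ler_pdivrMr//.
  exact/ltW/truncnS_gt.
have s_gt1 : 1 < tau - 1 by lra.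
have u_le : u * (3 + 4 * beta + 2 * d%:R * beta) <= (beta - 1 - beta / (tau - 1)) / 2.
  by rewrite -/M uM.
have d0 : 0 < d%:R :> R by rewrite ltr0n.
(* The constant can be 1 because [pr_many_informed] has the threshold n^(1 - rho) itself; all
   constants sit in the probability bound. *)
exists (rho d u), u, 1; split => //.
  by rewrite /rho divr_gt0// mulr_gt0.
move=> disp Omega P G Q.
pose S n := [set w | (num_informed (Q n) (Num.truncn (n%:R `^ u : R)) w)%:R
   <= 1 * n%:R `^ (1 - rho d u)].
have mS n : measurable (S n).
  exact: (measurable_num_informed (Q n) _
    (fun x => (x%:R : R) <= 1 * n%:R `^ (1 - rho d u))).
rewrite [X in X @ _ --> _](_ : _ = fun n => (pr (P n) (S n))%:E); last first.
  by apply/funext => n; rewrite prE.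
apply: (@cvg_probability1 _ (bound_const d theta1 theta2 beta C L) (u / 2)).
- have theta2_gt0 : 0 < theta2 by exact: lt_le_trans theta1_le.
  have C0 := ltW C_gt0.
  have c0 : 0 <= 3 * theta2 / theta1 * (2 ^+ d) `^ beta.
    by rewrite mulr_ge0 ?powR_ge0// divr_ge0 ?(ltW theta1_gt0)// mulr_ge0// ltW.
  rewrite /bound_const; apply: addr_ge0; last by rewrite mulr_ge0 ?exprn_ge0.
  apply: addr_ge0 => //; apply: addr_ge0; first by rewrite mulr_ge0.
  do 3 apply: mulr_ge0 => //.
  by apply: mulr_ge0; rewrite ?exprn_ge0// mulr_ge0// mulr_ge0.
- by rewrite divr_gt0.
move=> n n_gt0; rewrite pr_le1// andbT.
have bad := pr_many_informed d_gt0 theta1_gt0 theta1_le theta2_le u_gt0 eps_gt0 eps_le s_gt1 u_s du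
  beta_gt beta_lt beta_alpha epsL u_le C_gt0 tailC D_low (Q n) n_gt0.
set B := [set w | _] in bad.
have SB : ~` (S n) `<=` B.
  move=> w /negP; rewrite /B /= -ltNge mul1r => h.
  by rewrite truncn_lt_nat ?powR_ge0.
have mB : measurable B.
  exact: (measurable_num_informed (Q n) _ (fun x => (Num.truncn (n%:R `^ (1 - rho d u) : R) < x)%N)).
have := pr_mono (P n) (measurableC (mS n)) mB SB.
by rewrite pr_setC//; lra.
Qed.
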